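(* For every real $\lambda>0$ and every $n\in\mathbb{N}$ there exist integers $d_0>d_1>\cdots>d_{n-1}>0$ and a sequence of finite graphs $(G_s)_{s\ge 1}$ such that: every $G_s$ is $(d_0,d_1,\ldots,d_{n-1})$-regular, the number of vertices of $G_s$ tends to infinity as $s\to\infty$, and every $G_s$ is a $\lambda$-local spectral expander.
   Context: A finite graph $G=(V,E)$ is $(d_0,d_1,\ldots,d_{n-1})$-regular (for integers $d_0>d_1>\cdots>d_{n-1}>0$) if $G$ is $d_0$-regular and, for every $1\le i\le n-1$, for every clique $C$ of $G$ with $|C|=i$, the subgraph induced on the joint neighbourhood of $C$ (the set of vertices adjacent to all vertices of $C$) is $d_i$-regular. The clique complex $X(G)$ is the simplicial complex whose faces are the cliques of $G$; $X(i)$ denotes the set of faces with $i+1$ vertices. It is $d$-dimensional if the largest face has $d+1$ vertices, and pure if every face is contained in a face with $d+1$ vertices. For a face $\tau$, the link is $X_\tau=\{T\setminus\tau:\tau\subseteq T\in X\}$ (for $\tau=\emptyset$ it is $X$ itself). For a pure $d$-dimensional complex $X$, $\tau\in X(k)$ ($-1\le k\le d-2$, with $X(-1)=\{\emptyset\}$), the 1-skeleton of $X_\tau$ is weighted by $w(\{u,v\})=(d-k-2)!\,\bigl|\{\pi\in X_\tau(d-k-1):\{u,v\}\subseteq\pi\}\bigr|$, and its transition matrix is $T(v,u)=w(\{u,v\})/\sum_{x:\{x,v\}\in X_\tau(1)}w(\{x,v\})$ for edges $\{u,v\}$ and $0$ otherwise. For a weighted graph, $\lambda_2$ denotes the second largest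 eigenvalue (with multiplicity) of its transition matrix; the graph is a one-sided $\lambda$-spectral expander if $\lambda_2\le\lambda$. A pure $d$-dimensional simplicial complex $X$ is a one-sided $\lambda$-high-dimensional expander if the weighted 1-skeleton of $X$ and, for every $i\le d-2$ and every $s\in X(i)$, the weighted 1-skeleton of $X_s$ are one-sided $\lambda$-spectral expanders. A graph $G$ is a $\lambda$-local spectral expander if its clique complex $X(G)$ is pure and is a one-sided $\lambda$-high-dimensional expander. *)

(* Defs.v *)
From HB Require Import structures.
From mathcomp Require Import all_boot all_order all_algebra.
From mathcomp Require Import reals.
Set Implicit Arguments. Unset Strict Implicit. Unset Printing Implicit Defensive.
Import Order.TTheory GRing.Theory Num.Theory.
Local Open Scope ring_scope.

Definition simple_graph (N : nat) (adj : rel 'I_N) : Prop :=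
  symmetric adj /\ irreflexive adj.

(* cliques = faces of the clique complex (the empty set is a clique) *)
Definition is_clique (N : nat) (adj : rel 'I_N) (C : {set 'I_N}) : bool :=
  [forall u in C, forall v in C, (u != v) ==> adj u v].

Definition joint_nbhd (N : nat) (adj : rel 'I_N) (C : {set 'I_N}) : {set 'I_N} :=
  [set v | [forall u in C, adj u v]].

Definition induced_regular (N : nat) (adj : rel 'I_N) (S : {set 'I_N}) (k : nat) : Prop :=
  forall v, v \in S -> #|[set u in S | adj v u]| = k.

Definition regular_seq (N : nat) (adj : rel 'I_N) (n : nat) (d : nat -> nat) : Prop :=
  (forall v, #|[set u | adj v u]| = d 0%N) /\
  (forall i, (1 <= i < n)%N -> forall C : {set 'I_N},
      is_clique adj C -> #|C| = i -> induced_regular adj (joint_nbhd adj C) (d i)).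

(* number of vertices of a largest face of X(G) (= dimension + 1) *)
Definition clique_number (N : nat) (adj : rel 'I_N) : nat :=
  \max_(C : {set 'I_N} | is_clique adj C) #|C|.

Definition pure_clique_complex (N : nat) (adj : rel 'I_N) : Prop :=
  forall C, is_clique adj C ->
    exists C', [&& is_clique adj C', C \subset C' & #|C'| == clique_number adj].

Definition link_face (N : nat) (adj : rel 'I_N) (tau sigma : {set 'I_N}) : bool :=
  [disjoint sigma & tau] && is_clique adj (sigma :|: tau).

Definition link_vertex (N : nat) (adj : rel 'I_N) (tau : {set 'I_N}) (v : 'I_N) : bool :=
  link_face adj tau [set v].

Definition link_edge (N : nat) (adj : rel 'I_N) (tau : {set 'I_N}) (u v : 'I_N) : bool :=
  (u != v) && link_face adj tau [set u; v].

(* For tau in X(k) and X of dimension D = clique_number - 1: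
   w({u,v}) = (D-k-2)! * #{pi in X_tau(D-k-1) | {u,v} ⊆ pi},
   with D - k - 2 = clique_number - #|tau| - 2 and faces of X_tau(D-k-1)
   having clique_number - #|tau| vertices. *)
Definition link_weight (N : nat) (adj : rel 'I_N) (tau : {set 'I_N}) (u v : 'I_N) : nat :=
  ((clique_number adj - #|tau| - 2)`! *
   #|[set pi : {set 'I_N} | [&& link_face adj tau pi,
                               #|pi| == (clique_number adj - #|tau|)%N,
                               u \in pi & v \in pi]]|)%N.

Definition link_vertices (N : nat) (adj : rel 'I_N) (tau : {set 'I_N}) : {set 'I_N} :=
  [set v | link_vertex adj tau v].

Definition link_transition (R : realType) (N : nat) (adj : rel 'I_N) (tau : {set 'I_N})
  : 'M[R]_#|link_vertices adj tau| :=
  \matrix_(i, j)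
    (let v := enum_val i in let u := enum_val j in
     if link_edge adj tau u v then
       (link_weight adj tau u v)%:R /
       \sum_(x : 'I_N | link_edge adj tau x v) (link_weight adj tau x v)%:R
     else 0).

Definition is_lambda2 (R : realType) (m : nat) (T : 'M[R]_m) (l : R) : Prop :=
  exists s : seq R,
    [/\ char_poly T = \prod_(x <- s) ('X - x%:P), sorted >=%R s & s`_1 = l].

Definition one_sided_spectral_expander (R : realType) (m : nat) (T : 'M[R]_m) (lam : R) : Prop :=
  exists l, is_lambda2 T l /\ l <= lam.

(* G is a lam-local spectral expander: X(G) pure and for every face tau with
   tau in X(k), -1 <= k <= dim - 2 (i.e. #|tau| + 2 <= clique_number; tau = set0
   gives X itself) the weighted 1-skeleton of X_tau is a one-sided lam-expander. *)
Definition local_spectral_expander (R : realType) (N : nat) (adj : rel 'I_N) (lam : R) : Prop :=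
  pure_clique_complex adj /\
  forall tau : {set 'I_N}, is_clique adj tau ->
    (#|tau| + 2 <= clique_number adj)%N ->
    one_sided_spectral_expander (link_transition R adj tau) lam.

(* Main.v *)
Require Import Defs.
From HB Require Import structures.
From mathcomp Require Import all_boot all_order all_fingroup all_algebra.
From mathcomp Require Import complex reals ring lra zify.
From mathcomp Require boolp.
Set Implicit Arguments. Unset Strict Implicit. Unset Printing Implicit Defensive.
Import Order.TTheory GRing.Theory Num.Theory.
Local Open Scope ring_scope.

(** The graphs are 1-skeletons of coset complexes.  Let [m = n + 2] and take
    the path algebra over [F_p] of the cyclic quiver with [m] arrows, truncated at
    some length; its paths of positive length span the [m]-periodic strictly upper
    triangular matrices of a large size.  For a set [S] of arrows let [K_S] be the group of
    all [1 + a] with [a] in the span of the paths avoiding [S].  The coset complex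
    of the groups [K_l] (one arrow each) is flag, its links are connected, and its
    links of codimension two are complete bipartite graphs or incidence graphs of
    Heisenberg groups, whose second singular value is at most [p^(-1/2)].  The size of
    [K_S] does not depend on the truncation when [S] is nonempty, whereas the group
    generated by the [K_l] grows with it.

    To make all faces of the same dimension look alike, take the product of the
    copies of this family obtained by permuting the [m] types in all ways.  For a
    graph that is regular in this sense the transition matrix of a link is the
    normalised adjacency matrix, so Oppenheim's trickling-down argument applies:
    the inequality [T <= mu + (1 - mu) T^2] bounds by [mu / (1 - mu)] each
    eigenvalue of [T] below 1, and iterating from [1/t] at codimension two gives
    at most [1 / (t - m)] everywhere. *)

(** * Symmetric real matrices *)

(** Regularity and expansion are asked of the clique complex, which the graph alone determines, so
    every clique must come from cosets with a common element. A Helly argument reduces this to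
    triples of cosets; for the path groups a triple is settled by cutting the cycle open at one
    arrow and factoring [x = (1 + X) * (1 + Y)] by rows.

    One tuple of degrees must serve graphs of unbounded size. A nonempty set of removed arrows
    breaks the cycle, so the surviving paths are shorter than [m] whatever the truncation; the
    degrees involve only the orders of these groups, and only [K set0] grows. With two arrows a link
    of codimension two would already be the whole complex; [m = n + 2] gives three arrows at
    [n = 1].

    Trickling down says nothing about eigenvalues from 1 on. Connectivity handles these, through the
    generation of [K S] by the groups [K (l |: S)]. The reciprocal of the bound drops by exactly 1
    at each step, so [1/t] with [t > m + 1/lam] survives all steps, and the prime only has to
    satisfy [p >= t^2]. *)

Lemma symmetric_real_eigenvector (R : rcfType) n (A : 'M[R]_n.+1) :
  A^T = A -> exists a (v : 'rV_n.+1), v *m A = a *: v /\ v != 0.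
Proof.
move=> symA; set AC := map_mx (real_complex R) A.
have Ah : AC \is hermsymmx.
  apply: realsym_hermsym.
    by apply/is_hermitianmxP; rewrite expr0 scale1r map_mx_id // map_trmx symA.
  by apply/mxOverP => i j; rewrite mxE; apply/complex_realP; eexists.
have /hermitian_normalmx/orthomx_spectralP AE := Ah.
have /mxOverP/(_ 0 0)/complex_realP[a da] := hermitian_spectral_diag_real Ah.
have Pu := spectral_unit AC.
(* A complex eigenvector need not be real, but the eigenvalue is; being a root of the real
   characteristic polynomial, it has a real eigenvector. *)
suff : eigenvalue AC a%:C%C.
  rewrite eigenvalue_root_char -map_char_poly fmorph_root -eigenvalue_root_char.
  by case/eigenvalueP => v; exists a, v.
apply/eigenvalueP; exists (row 0 (spectralmx AC)).
  rewrite -row_mul {2}AE !mulmxA mulmxV // mul1mx row_mul -da.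
  by rewrite row_diag_mx -scalemxAl -rowE.
apply/eqP => r0; have := row_unitarymxP (spectral_unitarymx AC) 0 0.
by rewrite r0 dotmxE mul0mx mxE => /esym/eqP; rewrite oner_eq0.
Qed.

(** The reflection along [w = e - u] exchanges the first basis vector [e] with the unit vector [u]
    proportional to [v]. If [e = u] there is no such reflection and the identity serves. *)
Lemma householder (R : rcfType) n (v : 'rV[R]_n.+1) : v != 0 ->
  exists (Q : 'M[R]_n.+1) (c : R), Q *m Q^T = 1%:M /\ row 0 Q = c *: v.
Proof.
move=> v0.
have dot_gt0 (x : 'rV[R]_n.+1) : x != 0 -> 0 < (x *m x^T) 0 0.
  move=> x0; rewrite mxE lt0r; apply/andP; split; last first.
    by apply: sumr_ge0 => i _; rewrite mxE -expr2 sqr_ge0.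
  apply: contraNneq x0 => /eqP; rewrite psumr_eq0; last first.
    by move=> i _; rewrite mxE -expr2 sqr_ge0.
  move=> /allP x0; apply/eqP/rowP => i; rewrite [RHS]mxE.
  by have /= := x0 i (mem_index_enum _); rewrite mxE mulf_eq0 orbb => /eqP.
pose c := (Num.sqrt ((v *m v^T) 0 0))^-1; pose u := c *: v.
have uu : u *m u^T = 1%:M.
  apply/rowP => i; rewrite !ord1 /u linearZ /= -scalemxAl -scalemxAr scalerA.
  rewrite mxE [in RHS]mxE /c; move: (dot_gt0 _ v0); move: (_ 0 0) => s s0.
  by rewrite -expr2 -[X in _ * X]sqr_sqrtr ?ltW // -exprMn mulVf ?expr1n // sqrtr_eq0 -ltNge.
pose e : 'rV[R]_n.+1 := delta_mx 0 0.
have ee : e *m e^T = 1%:M.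
  by rewrite trmx_delta mul_delta_mx; apply/rowP => i; rewrite !ord1 !mxE eqxx.
case: (eqVneq e u) => [eu|neu].
  by exists 1%:M, c; rewrite trmx1 mulmx1; split=> //; rewrite row1 -/u -eu.
pose w := e - u; have w0 : w != 0 by rewrite subr_eq0.
have ue : u *m e^T = e *m u^T.
  by apply/rowP=> i; rewrite !ord1 -[u *m _]trmxK trmx_mul trmxK mxE.
set g := (e *m u^T) 0 0.
have gE : e *m u^T = g%:M by rewrite [LHS]mx11_scalar.
have ww : w *m w^T = (2 - 2 * g)%:M.
  rewrite linearB /= mulmxBl !mulmxBr ee uu ue gE.
  by rewrite -!raddfB /=; congr (_%:M); ring.
have g1 : 1 - g != 0.
  have := dot_gt0 _ w0; rewrite ww mxE eqxx mulr1n => /lt0r_neq0.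
  by apply: contra_neq => g1; have -> : g = 1 by [rewrite -[g](subKr 1) g1 subr0]; ring.
have ew : e *m w^T = (1 - g)%:M by rewrite linearB /= mulmxBr ee gE -raddfB.
pose Y := (1 - g)^-1 *: (w^T *m w); exists (1%:M - Y), c; split.
  have YT : Y^T = Y by rewrite /Y linearZ /= trmx_mul trmxK.
  have YY : Y *m Y = Y + Y.
    rewrite -scalemxAl -scalemxAr mulmxA -(mulmxA w^T) ww mul_mx_scalar.
    by rewrite -scalemxAl !scalerA -scalerDl; congr (_ *: _); field.
  rewrite linearB /= trmx1 YT; move: YY; move: (Y) => Z ZZ.
  rewrite mulmxBl mul1mx mulmxBr mulmx1 ZZ; apply/matrixP=> i j; rewrite !mxE; ring.
rewrite rowE [LHS]mulmxBr mulmx1 -scalemxAr mulmxA ew mul_scalar_mx scalerA mulVf //.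
by rewrite scale1r -/e /w opprB addrC subrK.
Qed.

(** Deflation: in an orthonormal basis whose first member is an eigenvector, symmetry clears the
    first column along with the first row and leaves a smaller symmetric block. *)
Lemma real_spectral (R : rcfType) n (A : 'M[R]_n) : A^T = A ->
  exists (P : 'M[R]_n) (d : 'rV[R]_n), P *m P^T = 1%:M /\ P *m A *m P^T = diag_mx d.
Proof.
elim: n => [|n IHn] in A *; first by exists 1%:M, 0; split; rewrite [LHS]flatmx0 [RHS]flatmx0.
move=> symA; have [a [v [vA v0]]] := symmetric_real_eigenvector symA.
have [Q [c [QQ Q0]]] := householder v0.
have [B BE] : exists B : 'M[R]_(1 + n), B = Q *m A *m Q^T by eexists.
have symB : B^T = B by rewrite BE !trmx_mul trmxK symA mulmxA.
have rB : row 0 B = a *: delta_mx 0 0.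
  rewrite BE row_mul row_mul Q0 -scalemxAl vA scalerA mulrC -scalerA -Q0.
  by rewrite -scalemxAl -row_mul QQ row1.
have urB : ursubmx B = 0.
  apply/matrixP => i j; rewrite !mxE ord1.
  have /rowP/(_ (rshift 1 j)) := rB; rewrite !mxE /= mulr0 => <-.
  by congr (B _ _); apply/val_inj.
have dlB : dlsubmx B = 0 by rewrite -[LHS]trmxK trmx_dlsub symB urB trmx0.
have ulB : ulsubmx B = a%:M.
  apply/matrixP => i j; rewrite !ord1 !mxE eqxx mulr1n.
  have /rowP/(_ 0) := rB; rewrite !mxE /= mulr1 => <-.
  by congr (B _ _); apply/val_inj.
have symD : (drsubmx B)^T = drsubmx B by rewrite trmx_drsub symB.
have [P [d [PP PD]]] := IHn _ symD.
pose P1 : 'M[R]_(1 + n) := block_mx 1%:M 0 0 P.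
have P1P1 : P1 *m P1^T = 1%:M.
  rewrite tr_block_mx mulmx_block !trmx0 !mul0mx !mulmx0 !addr0 add0r trmx1 mulmx1.
  by rewrite PP -scalar_mx_block.
have P1B : P1 *m B *m P1^T = diag_mx (row_mx (a%:M : 'rV_1) d).
  rewrite -[B]submxK urB dlB ulB tr_block_mx !mulmx_block !trmx0 trmx1.
  rewrite !(mul0mx, mulmx0, addr0, add0r, mul1mx, mulmx1) PD diag_mx_row.
  by congr block_mx; apply/rowP => i; rewrite !ord1 !mxE eqxx.
exists (P1 *m Q), (row_mx (a%:M : 'rV_1) d); split.
  by rewrite trmx_mul mulmxA -(mulmxA P1) QQ mulmx1.
by rewrite -P1B BE trmx_mul !mulmxA.
Qed.

Lemma char_poly_orthodiag (R : comNzRingType) n (A P : 'M[R]_n) d :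
  P *m P^T = 1%:M -> P *m A *m P^T = diag_mx d ->
  char_poly A = \prod_(i < n) ('X - (d 0 i)%:P).
Proof.
move=> PP PA; transitivity (char_poly (diag_mx d)); last first.
  rewrite char_poly_trig ?diag_mx_is_trig //.
  by apply: eq_bigr => i _; rewrite mxE eqxx mulr1n.
pose p := map_mx (@polyC R) P; have pp : p *m p^T = 1%:M.
  by rewrite /p map_trmx -map_mxM PP map_mx1.
rewrite /char_poly; have -> : char_poly_mx (diag_mx d) = p *m char_poly_mx A *m p^T.
  rewrite /char_poly_mx mulmxBr mulmxBl -PA !map_mxM -map_trmx.
  by rewrite mul_mx_scalar -scalemxAl pp scalemx1.
rewrite !det_mulmx mulrAC -det_mulmx pp det1 mul1r //.
Qed.

Definition mxdot (R : pzSemiRingType) n (f g : 'rV[R]_n) : R := (f *m g^T) 0 0.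

Lemma mxdotE (R : pzSemiRingType) n (f g : 'rV[R]_n) : mxdot f g = \sum_i f 0 i * g 0 i.
Proof. by rewrite /mxdot mxE; apply: eq_bigr => i _; rewrite mxE. Qed.

Lemma mxdot_diag (R : comPzRingType) n (d f : 'rV[R]_n) :
  mxdot (f *m diag_mx d) f = \sum_i d 0 i * f 0 i ^+ 2.
Proof.
rewrite mxdotE; apply: eq_bigr => i _.
by rewrite mul_mx_diag mxE mulrAC mulrC.
Qed.

Section OrthoDiag.
Variables (R : realFieldType) (n : nat) (A P : 'M[R]_n) (d : 'rV[R]_n).
Hypotheses (PP : P *m P^T = 1%:M) (PA : P *m A *m P^T = diag_mx d).

Lemma orthodiagE : P *m A = diag_mx d *m P.
Proof. by rewrite -PA -mulmxA (mulmx1C PP) mulmx1. Qed.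

Lemma mxdot_ortho f g : mxdot (f *m P) (g *m P) = mxdot f g.
Proof. by rewrite /mxdot trmx_mul mulmxA -(mulmxA f) PP mulmx1. Qed.

Lemma orthodiag_row i : row i P *m A = d 0 i *: row i P.
Proof. by rewrite -row_mul orthodiagE row_mul row_diag_mx -scalemxAl -rowE. Qed.

Lemma mxdot_row i j : mxdot (row i P) (row j P) = (i == j)%:R.
Proof.
rewrite mxdotE; have /matrixP/(_ i j) := PP; rewrite !mxE => <-.
by apply: eq_bigr => k _; rewrite !mxE.
Qed.

Lemma mxdot_rowr f i : mxdot (f *m P) (row i P) = f 0 i.
Proof.
rewrite rowE mxdot_ortho /mxdot trmx_delta -colE mxE //.
Qed.

End OrthoDiag.

(** On a unit eigenvector with eigenvalue [a] the quadratic hypothesis reads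
    [0 <= (a - 1) * ((1 - mu) * a - mu)], so [a < 1] forces [a <= mu / (1 - mu)]. Eigenvectors with
    [1 <= a] are multiples of [u], to which [f] is orthogonal. *)
Lemma trickle_down_form (R : realType) n (A : 'M[R]_n) (u : 'rV[R]_n) mu :
  A^T = A -> 0 <= mu < 1 ->
  (forall f, mxdot (f *m A) f <= mu * mxdot f f + (1 - mu) * mxdot (f *m A) (f *m A)) ->
  (forall f a, f *m A = a *: f -> 1 <= a -> exists c, f = c *: u) ->
  forall f, mxdot f u = 0 -> mxdot (f *m A) f <= mu / (1 - mu) * mxdot f f.
Proof.
move=> symA /andP[mu0 mu1] HA Hu f fu.
have [P [d [PP PA]]] := real_spectral symA.
have fE : f = f *m P^T *m P by rewrite -mulmxA (mulmx1C PP) mulmx1.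
set y := f *m P^T in fE.
have -> : mxdot (f *m A) f = \sum_i d 0 i * y 0 i ^+ 2.
  by rewrite fE -mulmxA (orthodiagE PP PA) mulmxA mxdot_ortho // mxdot_diag.
rewrite {1 2}fE mxdot_ortho // mxdotE mulr_sumr; apply: ler_sum => i _.
rewrite -expr2; set a := d 0 i.
have rA := orthodiag_row PP PA i; rewrite -/a in rA.
have := HA (row i P); rewrite rA.
have -> : mxdot (a *: row i P) (a *: row i P) = a ^+ 2.
  rewrite /mxdot linearZ /= -scalemxAl -scalemxAr scalerA mxE.
  by rewrite -[(_ *m _) 0 0]/(mxdot _ _) mxdot_row // eqxx mulr1.
have -> : mxdot (a *: row i P) (row i P) = a.
  rewrite /mxdot -scalemxAl mxE.
  by rewrite -[(_ *m _) 0 0]/(mxdot _ _) mxdot_row // eqxx mulr1.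
rewrite mxdot_row // eqxx mulr1 => Ha.
have [a1|a1] := leP 1 a.
  have [c cu] := Hu _ _ rA a1.
  have -> : y 0 i = 0.
    rewrite -(mxdot_rowr PP y) -fE cu /mxdot linearZ /= -scalemxAr mxE.
    by rewrite -[(_ *m _) 0 0]/(mxdot _ _) fu mulr0.
  by rewrite expr0n /= !mulr0.
apply: ler_wpM2r; first exact: sqr_ge0.
rewrite ler_pdivlMr ?subr_gt0 //; nra.
Qed.

(** Courant-Fischer: if two eigenvalues exceeded [b], the plane spanned by their eigenvectors would
    contain a nonzero vector orthogonal to [u], on which the form is too large. *)
Lemma expander_of_form (R : realType) n (A : 'M[R]_n) (u : 'rV[R]_n) b :
  A^T = A -> 0 <= b ->
  (forall f, mxdot f u = 0 -> mxdot (f *m A) f <= b * mxdot f f) ->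
  one_sided_spectral_expander A b.
Proof.
move=> symA b0 HA; have [P [d [PP PA]]] := real_spectral symA.
pose ds := [seq d 0 i | i <- Finite.enum 'I_n]; pose s := sort >=%R ds.
have ss : sorted >=%R s by apply: sort_sorted; apply: ge_total.
exists s`_1; split.
  exists s; split => //; rewrite (char_poly_orthodiag PP PA).
  rewrite (perm_big ds) /=; last by rewrite perm_sort.
  by rewrite big_map -enumT big_enum.
rewrite leNgt; apply/negP => bs.
have s2 : leq 2 (count (fun x => b < x) s).
  move: ss bs; case: (s) => [|x [|y r]] /=; rewrite ?ltNge ?b0 // => /andP[yx _].
  by rewrite -!ltNge => by_; rewrite by_ (lt_le_trans by_ yx).
have : leq 2 #|[pred i | b < d 0 i]|.
  by move: s2; rewrite count_sort count_map cardE /enum_mem size_filter.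
case/card_gt1P => i [j [bi bj ij]].
rewrite !inE in bi bj.
have H al be : al * mxdot (row i P) u + be * mxdot (row j P) u = 0 ->
    (d 0 i - b) * al ^+ 2 + (d 0 j - b) * be ^+ 2 <= 0.
  pose y : 'rV[R]_n := al *: delta_mx 0 i + be *: delta_mx 0 j.
  have yi k : y 0 k = al * (k == i)%:R + be * (k == j)%:R.
    by rewrite !mxE !eqxx.
  move=> z0; have /HA : mxdot (y *m P) u = 0.
    rewrite -z0 /y mulmxDl -!scalemxAl -!rowE /mxdot mulmxDl -!scalemxAl.
    by rewrite !mxE.
  rewrite -mulmxA (orthodiagE PP PA) mulmxA !mxdot_ortho // mxdot_diag mxdotE.
  rewrite mulr_sumr -subr_le0 -sumrB.
  rewrite (bigD1 i) //= (bigD1 j) /=; last by rewrite eq_sym.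
  rewrite big1 => [|k /andP[ki kj]]; last first.
    by rewrite yi (negPf ki) (negPf kj) !mulr0 addr0 expr0n !mulr0 subr0.
  rewrite !yi !eqxx (negPf ij) eq_sym (negPf ij) !mulr1 !mulr0 !addr0 add0r.
  by congr (_ <= _); ring.
case: (eqVneq (mxdot (row j P) u) 0) => [uj|uj].
  by have := H 0 1; rewrite uj => /(_ ltac:(by ring)); rewrite expr0n expr1n /= mulr0 mulr1 add0r subr_le0 leNgt bj.
have := H (mxdot (row j P) u) (- mxdot (row i P) u) => /(_ ltac:(by ring)).
have : 0 < mxdot (row j P) u ^+ 2 by rewrite exprn_even_gt0.
have : 0 <= (- mxdot (row i P) u) ^+ 2 by rewrite sqr_ge0.
move: (_ ^+ 2) (_ ^+ 2) => x y; nra.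
Qed.

(** * Trickling down in hyper-regular graphs *)

Section Cliques.
Variables (N : nat) (adj : rel 'I_N).
Hypotheses (sadj : symmetric adj) (iadj : irreflexive adj).
Implicit Types (C : {set 'I_N}) (u v w : 'I_N).
Local Notation J := (joint_nbhd adj).
Local Notation clique := (is_clique adj).

Lemma cliqueP C : reflect {in C &, forall u v, u != v -> adj u v} (clique C).
Proof.
apply: (iffP forallP) => [H u v uC vC uv|H u].
  by have /implyP/(_ uC)/forallP/(_ v)/implyP/(_ vC)/implyP/(_ uv) := H u.
apply/implyP => uC; apply/forallP => v; apply/implyP => vC.
by apply/implyP; apply: H.
Qed.

Lemma joint_nbhdP C v : reflect {in C, forall u, adj u v} (v \in J C).
Proof.
rewrite inE; apply: (iffP forallP) => [H u uC|H u]; first exact: (implyP (H u)).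
by apply/implyP; apply: H.
Qed.

Lemma clique_sub C C' : C \subset C' -> clique C' -> clique C.
Proof.
move=> /subsetP CC' /cliqueP H; apply/cliqueP => u v uC vC.
by apply: H; apply: CC'.
Qed.

Lemma joint_nbhd_notin C v : v \in J C -> v \notin C.
Proof. by move/joint_nbhdP => H; apply/negP => /H; rewrite iadj. Qed.

Lemma cliqueU1 C v : clique C -> v \in J C -> clique (v |: C).
Proof.
move=> /cliqueP cC /joint_nbhdP vC; apply/cliqueP => u w.
move=> /setU1P[->|uC] /setU1P[->|wC]; rewrite ?eqxx // => uw.
- by rewrite sadj vC.
- exact: vC.
- exact: cC.
Qed.

Lemma joint_nbhd_clique C v : clique (v |: C) -> v \notin C -> v \in J C.
Proof.
move=> /cliqueP H vC; apply/joint_nbhdP => u uC.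
apply: H; rewrite ?setU11 ?setU1r //.
by apply: contraNneq vC => <-.
Qed.

Lemma joint_nbhdU1 C v w : (w \in J (v |: C)) = adj v w && (w \in J C).
Proof.
apply/joint_nbhdP/andP => [H|[vw /joint_nbhdP H] u /setU1P[->//|]]; last exact: H.
split; first by apply: H; rewrite setU11.
by apply/joint_nbhdP => u uC; apply: H; rewrite setU1r.
Qed.

Lemma card_joint_nbhdU1 C v : v \in J C -> #|v |: C| = #|C|.+1.
Proof. by move=> vJ; rewrite cardsU1 joint_nbhd_notin. Qed.

Lemma link_verticesE tau : clique tau -> link_vertices adj tau = J tau.
Proof.
move=> ct; apply/setP => v; rewrite inE /link_vertex /link_face disjoints1.
apply/andP/idP => [[vt cv]|vJ]; first exact: joint_nbhd_clique.
by split; [exact: joint_nbhd_notin | exact: cliqueU1].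
Qed.

Lemma link_edgeE tau u v : clique tau ->
  link_edge adj tau u v = [&& u \in J tau, v \in J tau & adj u v].
Proof.
move=> ct; rewrite /link_edge /link_face; apply/idP/and3P.
  case/and3P => uv; rewrite disjoints_subset subUset !sub1set !in_setC => /andP[ut vt].
  move=> cuv; split.
  - apply: (joint_nbhd_clique _ ut); apply: clique_sub cuv; by rewrite setSU // subsetUl.
  - apply: (joint_nbhd_clique _ vt); apply: clique_sub cuv; by rewrite setSU // subsetUr.
  - by move/cliqueP: cuv; apply; rewrite // !inE eqxx ?orbT.
case=> uJ vJ uv; apply/and3P; split.
- by apply/eqP => e; rewrite e iadj in uv.
- by rewrite disjoints_subset subUset !sub1set !in_setC !joint_nbhd_notin.
- rewrite -setUA; apply: cliqueU1; first exact: cliqueU1.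
  by rewrite joint_nbhdU1 sadj uv.
Qed.

End Cliques.

Section RowOf.
Variables (R : realType) (N : nat) (S : {set 'I_N}).

(** Functions live on all of ['I_N] and are restricted here, so that one function can be tested on
    every link although the row types have different lengths. *)
Definition row_of (f : 'I_N -> R) : 'rV[R]_#|S| := \row_i f (enum_val i).

Lemma mxdot_row_of f g : mxdot (row_of f) (row_of g) = \sum_(u in S) f u * g u.
Proof. by rewrite mxdotE [RHS]big_enum_val; apply: eq_bigr => i _; rewrite !mxE. Qed.

Lemma row_of_surj y : exists f, y = row_of f.
Proof.
exists (fun u => \sum_(i | enum_val i == u) y 0 i).
apply/rowP => i; rewrite mxE (bigD1 i) //= big1 ?addr0 // => j /andP[/eqP e].
by rewrite (enum_val_inj e) eqxx.
Qed.

End RowOf.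

(** * Garland's method in hyper-regular clique complexes *)

Section HyperRegular.
Variables (R : realType) (N : nat) (adj : rel 'I_N) (m : nat) (h : nat -> nat).
Hypotheses (sadj : symmetric adj) (iadj : irreflexive adj).
Local Notation J := (joint_nbhd adj).
Local Notation clique := (is_clique adj).
Hypothesis card_J : forall C, clique C -> (0 < #|C|)%N -> #|J C| = h #|C|.
Hypothesis h_gt0 : forall k, (0 < k < m)%N -> (0 < h k)%N.
Hypothesis clique_le : forall C, clique C -> (#|C| <= m)%N.
Hypothesis clique_ext : forall C, clique C ->
  exists C', [&& clique C', C \subset C' & #|C'| == m].
Implicit Types (C tau : {set 'I_N}) (u v w : 'I_N) (f g : 'I_N -> R).

Lemma clique_set0 : clique set0.
Proof. by apply/cliqueP => u v; rewrite inE. Qed.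

Lemma clique_numberE : clique_number adj = m.
Proof.
apply/eqP; rewrite eqn_leq; apply/andP; split.
  by apply/bigmax_leqP => C; apply: clique_le.
have [C /and3P[cC _ /eqP <-]] := clique_ext clique_set0.
exact: (leq_bigmax_cond (F := fun C : {set 'I_N} => #|C|)).
Qed.

Lemma clique_ext_pure : pure_clique_complex adj.
Proof. by move=> C; rewrite clique_numberE; apply: clique_ext. Qed.

Definition chambers C := [set pi | [&& clique pi, #|pi| == m & C \subset pi]].

(** Count in two ways the pairs of a chamber containing [C] and a vertex of that chamber outside
    [C]. *)
Lemma chambers_rec C : clique C -> ((m - #|C|) * #|chambers C| =
  \sum_(w in J C) #|chambers (w |: C)|)%N.
Proof.
move=> cC.
have chE w : #|chambers (w |: C)| = (\sum_(pi in chambers C) (w \in pi))%N.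
  rewrite -sum1_card [RHS]big_mkcond [LHS]big_mkcond; apply: eq_bigr => pi _.
  by rewrite !inE subUset sub1set; case: (clique _); case: eqP; case: (w \in pi) => //; case: (C \subset pi).
under eq_bigr do rewrite chE.
rewrite exchange_big /= mulnC -sum_nat_const; apply: eq_bigr => pi.
rewrite inE => /and3P[cpi /eqP <- Cpi].
rewrite -cardsDS // -sum1_card [RHS]big_mkcond [LHS]big_mkcond.
apply: eq_bigr => w _; rewrite inE.
case: (boolP (w \in pi)) => wpi; rewrite ?andbF ?andbT //; last by case: ifP.
case: (boolP (w \in C)) => wC /=.
  by case: ifP => // /(joint_nbhd_notin iadj); rewrite wC.
rewrite (joint_nbhd_clique _ wC) //.
by apply: clique_sub cpi; rewrite subUset sub1set wpi.
Qed.

(** Descending induction on [k] through [chambers_rec]. Since link weights count chambers, all edges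
    of a link get the same weight, which cancels in the transition matrix. *)
Lemma card_chambers k : (0 < k <= m)%N ->
  exists2 c, (0 < c)%N & forall C, clique C -> #|C| = k -> #|chambers C| = c.
Proof.
move: {2}(m - k)%N (erefl (m - k)%N) => j; elim: j k => [|j IH] k mk /andP[k0 km].
  have -> : k = m by lia.
  exists 1%N => // C cC Cm; rewrite -(cards1 C); apply: eq_card => pi.
  rewrite !inE; apply/and3P/eqP => [[cpi /eqP pim Cpi]|->]; last by rewrite Cm.
  by apply/eqP; rewrite eq_sym eqEcard Cpi pim Cm /=.
have [||c c0 Hc] := IH k.+1; try lia.
exists ((h k * c) %/ (m - k))%N; last first.
  move=> C cC Ck; have := chambers_rec cC.
  rewrite (eq_bigr (fun=> c)) => [|w wJ]; last first.
    by apply: Hc; [exact: cliqueU1 | rewrite (card_joint_nbhdU1 iadj wJ) Ck].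
  rewrite sum_nat_const card_J ?Ck // => <-; rewrite mulKn //; lia.
(* The quotient is shown positive on an actual clique of size [k], cut out of a maximal one. *)
have [C0 /and3P[cC0 _ /eqP C0m]] := clique_ext clique_set0.
have [C CC0 Ck] : exists2 C : {set 'I_N}, C \subset C0 & #|C| = k.
  exists [set x in take k (enum C0)].
    by apply/subsetP => x; rewrite inE => /mem_take; rewrite mem_enum.
  rewrite cardsE (card_uniqP _) ?take_uniq ?enum_uniq // size_take -cardE C0m.
  by case: ltnP; lia.
have cC := clique_sub CC0 cC0.
have := chambers_rec cC.
rewrite (eq_bigr (fun=> c)) => [|w wJ]; last first.
  by apply: Hc; [exact: cliqueU1 | rewrite (card_joint_nbhdU1 iadj wJ) Ck].
rewrite sum_nat_const card_J ?Ck // => e.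
rewrite -e mulKn; last by lia.
have hk : (0 < h k)%N by apply: h_gt0; lia.
by rewrite lt0n; apply/eqP => z; move: e; rewrite z; nia.
Qed.

Lemma link_weightE tau u v : clique tau -> u \in J tau -> v \in J tau -> 
  link_weight adj tau u v = ((m - #|tau| - 2)`! * #|chambers (u |: (v |: tau))|)%N.
Proof.
move=> ct uJ vJ; rewrite /link_weight clique_numberE; congr (_ * _)%N.
set X := [set pi | _]; have injX : {in X &, injective (fun pi => pi :|: tau)}.
  move=> p q; rewrite !inE => /and4P[/andP[pt _] _ _ _] /and4P[/andP[qt _] _ _ _] e.
  have E (r : {set 'I_N}) : [disjoint r & tau] -> (r :|: tau) :\: tau = r.
    by rewrite -setI_eq0 => /eqP rt; rewrite setDUl setDv setU0 -[RHS](setID _ tau) rt set0U.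
  by rewrite -(E p pt) e E.
rewrite -(card_in_imset injX); apply: eq_card => q; apply/imsetP/idP.
  case=> p; rewrite inE => /and4P[/andP[pt cp] /eqP pm up vp] ->.
  rewrite inE cp /= !subUset !sub1set !inE up vp subsetUr !andbT.
  rewrite cardsU; have /eqP -> : p :&: tau == set0 by rewrite setI_eq0.
  by rewrite cards0 pm; have := clique_le ct; lia.
rewrite inE !subUset !sub1set => /and3P[cq /eqP qm /and3P[uq vq tq]].
have e : (q :\: tau) :|: tau = q.
  by rewrite setDE setUIl [~: tau :|: _]setUC setUCr setIT (setUidPl tq).
exists (q :\: tau) => //.
rewrite inE /link_face e cq !inE uq vq !(joint_nbhd_notin iadj) //= !andbT.
by rewrite disjoints_subset setDE subsetIr -setDE cardsDS // qm eqxx.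
Qed.

Lemma link_transitionE tau (i j : 'I_#|link_vertices adj tau|) :
  clique tau -> (#|tau| + 2 <= m)%N ->
  link_transition R adj tau i j =
  (adj (enum_val i) (enum_val j))%:R / (h #|tau|.+1)%:R.
Proof.
move=> ct km; rewrite mxE /=.
have inJ (l : 'I_#|link_vertices adj tau|) : enum_val l \in J tau.
  by rewrite -link_verticesE ?enum_valP.
set v := enum_val i; set u := enum_val j.
rewrite link_edgeE // !inJ /= sadj; case: ifP => uv; last by rewrite mul0r.
have [|c c0 Hc] := @card_chambers (#|tau| + 2); first by lia.
set W := ((m - #|tau| - 2)`! * c)%N.
have W0 : (W%:R : R) != 0 by rewrite pnatr_eq0 -lt0n muln_gt0 fact_gt0.
have wE x y : x \in J tau -> y \in J tau -> adj x y -> link_weight adj tau x y = W.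
  move=> xJ yJ xy; rewrite link_weightE // Hc //.
    by do 2?apply: cliqueU1 => //; rewrite joint_nbhdU1 // sadj xy.
  have xJ' : x \in J (y |: tau) by rewrite joint_nbhdU1 // sadj xy.
  by rewrite (card_joint_nbhdU1 iadj xJ') (card_joint_nbhdU1 iadj yJ) addn2.
rewrite wE ?inJ //; last by rewrite sadj.
rewrite (eq_bigr (fun=> W%:R)); last first.
  by move=> x; rewrite link_edgeE // => /and3P[xJ vJ xv]; rewrite wE.
rewrite sumr_const -[#|_|]/#|[pred x | link_edge adj tau x v]|.
have -> : #|[pred x | link_edge adj tau x v]| = h #|tau|.+1.
  rewrite -(card_joint_nbhdU1 iadj (inJ i)) -card_J; first last.
  - by rewrite (card_joint_nbhdU1 iadj (inJ i)).
  - exact: cliqueU1.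
  by apply: eq_card => x; rewrite [LHS]inE link_edgeE // joint_nbhdU1 // inJ sadj /= andbC.
rewrite -[_ *+ h _]mulr_natr invfM mulrA divff // mul1r //.
Qed.

Lemma link_transition_sym tau : clique tau -> (#|tau| + 2 <= m)%N ->
  (link_transition R adj tau)^T = link_transition R adj tau.
Proof.
move=> ct km; apply/matrixP => i j; rewrite mxE !link_transitionE //.
by rewrite sadj.
Qed.

(** For [u] in the link of [tau] the set [J (u |: tau)] is its neighbourhood there, so this is the
    adjacency operator of the link before normalisation. *)
Definition nbhd_sum tau f u : R := \sum_(v in J (u |: tau)) f v.

Lemma row_of_transition tau f : clique tau -> (#|tau| + 2 <= m)%N ->
  row_of _ f *m link_transition R adj tau =
  row_of _ (fun u => nbhd_sum tau f u / (h #|tau|.+1)%:R).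
Proof.
move=> ct km; apply/rowP => j; rewrite !mxE.
under eq_bigr => i _ do rewrite mxE link_transitionE // mulrA.
rewrite -mulr_suml; congr (_ / _).
transitivity (\sum_(u in link_vertices adj tau) f u * (adj u (enum_val j))%:R).
  by rewrite [RHS]big_enum_val.
move: (enum_val j) => w; rewrite link_verticesE // [LHS]big_mkcond [RHS]big_mkcond; apply: eq_bigr => u _.
by rewrite joint_nbhdU1 sadj; case: (adj w u); case: ifP; rewrite ?mulr1 ?mulr0.
Qed.

Lemma card_J_U1 tau u : clique tau -> u \in J tau -> #|J (u |: tau)| = h #|tau|.+1.
Proof.
move=> ct uJ; rewrite card_J ?(card_joint_nbhdU1 iadj uJ) //; exact: cliqueU1.
Qed.

Lemma sum_joint_nbhd_swap (V : nmodType) tau (F : 'I_N -> 'I_N -> V) :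
  \sum_(w in J tau) \sum_(u in J (w |: tau)) F w u =
  \sum_(u in J tau) \sum_(w in J (u |: tau)) F w u.
Proof.
rewrite (exchange_big_dep (mem (J tau))) /=; last first.
  by move=> w u _; rewrite joint_nbhdU1 => /andP[].
apply: eq_bigr => u uJ; apply: eq_bigl => w.
by rewrite !joint_nbhdU1 uJ andbT sadj andbC.
Qed.

Definition adj_form tau f : R := \sum_(u in J tau) f u * nbhd_sum tau f u.

(** An inequality between quadratic forms can be summed over the links of all vertices, unlike a
    statement on eigenvalues. The factor [h #|tau|.+1] is the valency of the link. *)
Definition link_gap tau (mu : R) := forall f, \sum_(u in J tau) f u = 0 ->
  adj_form tau f <= mu * (h #|tau|.+1)%:R * \sum_(u in J tau) f u ^+ 2.

(** Connectivity in the form in which it is used: an eigenvector with eigenvalue at least 1 turns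
    out constant along edges, and must then be constant. *)
Definition link_connected tau := forall f,
  {in J tau &, forall u v, adj u v -> f u = f v} -> {in J tau &, forall u v, f u = f v}.

Lemma sum_nbhd_sum tau f : clique tau ->
  \sum_(u in J tau) nbhd_sum tau f u = (h #|tau|.+1)%:R * \sum_(u in J tau) f u.
Proof.
move=> ct; rewrite sum_joint_nbhd_swap mulr_sumr; apply: eq_bigr => u uJ.
by rewrite sumr_const card_J_U1 // mulr_natl.
Qed.

Lemma mxdot_transition tau f : clique tau -> (#|tau| + 2 <= m)%N ->
  mxdot (row_of _ f *m link_transition R adj tau) (row_of _ f) =
  adj_form tau f / (h #|tau|.+1)%:R.
Proof.
move=> ct km; rewrite row_of_transition // mxdot_row_of link_verticesE //.
by rewrite mulr_suml; apply: eq_bigr => u _; rewrite mulrC mulrA.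
Qed.

Lemma mxdot_J tau f g : clique tau -> 
  mxdot (row_of (link_vertices adj tau) f) (row_of _ g) = \sum_(u in J tau) f u * g u.
Proof. by move=> ct; rewrite mxdot_row_of link_verticesE. Qed.

Lemma expander_of_gap tau lam : clique tau -> (#|tau| + 2 <= m)%N -> 0 <= lam ->
  link_gap tau lam -> one_sided_spectral_expander (link_transition R adj tau) lam.
Proof.
move=> ct km lam0 gap.
have h1 : 0 < (h #|tau|.+1)%:R :> R by rewrite ltr0n h_gt0 //; lia.
apply: (expander_of_form (u := row_of _ (fun=> 1)) (link_transition_sym ct km) lam0).
move=> y; have [f ->] := row_of_surj y; rewrite mxdot_J // => f0.
rewrite mxdot_transition // mxdot_J // ler_pdivrMr // mulrAC.
apply: gap; rewrite -[RHS]f0; apply: eq_bigr => u _; rewrite mulr1 //.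
Qed.

(** Apply the gap to [f] minus its mean over the link. The constant part carries eigenvalue 1
    instead of [mu], which gives the extra term with factor [1 - mu]. *)
Lemma link_gap_mean tau mu f : clique tau -> (0 < #|tau| < m)%N -> link_gap tau mu ->
  adj_form tau f <= (h #|tau|.+1)%:R * (mu * (\sum_(u in J tau) f u ^+ 2) +
     (1 - mu) * (\sum_(u in J tau) f u) ^+ 2 / (h #|tau|)%:R).
Proof.
move=> ct /andP[k0 km] gap.
set d := (h #|tau|.+1)%:R; set A := \sum_(u in J tau) f u; set n := (h _)%:R.
have n0 : n != 0 by rewrite pnatr_eq0 -lt0n h_gt0 ?k0.
have cJ (c : R) : \sum_(u in J tau) c = c * n.
  by rewrite sumr_const card_J // mulr_natr.
pose c := A / n.
have g0 : \sum_(u in J tau) (f u - c) = 0.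
  by rewrite sumrB cJ /c divfK ?subrr.
rewrite -subr_ge0; have := gap _ g0; rewrite -subr_ge0.
have -> : \sum_(u in J tau) (f u - c) ^+ 2 = \sum_(u in J tau) f u ^+ 2 - A ^+ 2 / n.
  transitivity (\sum_(u in J tau) (f u ^+ 2 - (c *+ 2 * f u - c ^+ 2))).
    by apply: eq_bigr => u _; ring.
  by rewrite sumrB sumrB -mulr_sumr -/A cJ /c; field.
have -> : adj_form tau (fun u => f u - c) = adj_form tau f - d * (A ^+ 2 / n).
  transitivity (\sum_(u in J tau) (f u * nbhd_sum tau f u -
      (c * d * f u + c * nbhd_sum tau f u - c ^+ 2 * d))).
    apply: eq_bigr => u uJ.
    have -> : nbhd_sum tau (fun u => f u - c) u = nbhd_sum tau f u - c * d.
      by rewrite /nbhd_sum sumrB sumr_const card_J_U1 // mulr_natr.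
    by ring.
  rewrite sumrB sumrB big_split /= -!mulr_sumr sum_nbhd_sum // cJ -/A -/d -/(adj_form _ _).
  by rewrite /c; field.
by congr (0 <= _); ring.
Qed.

(** Garland's localisation: an edge of the link of [tau] lies in the link of [w |: tau] for each of
    its [h #|tau|.+2] common neighbours [w]. *)
Lemma adj_form_local tau f : clique tau ->
  \sum_(w in J tau) adj_form (w |: tau) f = (h #|tau|.+2)%:R * adj_form tau f.
Proof.
move=> ct; rewrite /adj_form sum_joint_nbhd_swap mulr_sumr; apply: eq_bigr => u uJ.
have cu := cliqueU1 sadj ct uJ.
rewrite -mulr_sumr mulrCA; congr (_ * _).
transitivity (\sum_(w in J (u |: tau)) nbhd_sum (u |: tau) f w).
  by apply: eq_bigr => w _; rewrite /nbhd_sum setUCA.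
by rewrite sum_nbhd_sum // (card_joint_nbhdU1 iadj uJ).
Qed.

Lemma sum_sqr_local tau f : clique tau ->
  \sum_(w in J tau) \sum_(u in J (w |: tau)) f u ^+ 2 =
  (h #|tau|.+1)%:R * \sum_(u in J tau) f u ^+ 2.
Proof.
by move=> ct; rewrite -(sum_nbhd_sum (fun u => f u ^+ 2) ct).
Qed.

(** Sum [link_gap_mean] over the links of all [w |: tau]. The sum of [f] over such a link is
    [nbhd_sum tau f w], so the mean terms assemble into the squared norm of the adjacency operator
    applied to [f]; this is [T <= mu + (1 - mu) T^2]. *)
Lemma adj_form_local_le tau mu f : clique tau -> (#|tau| + 3 <= m)%N ->
  {in J tau, forall w, link_gap (w |: tau) mu} ->
  adj_form tau f <= mu * (h #|tau|.+1)%:R * (\sum_(u in J tau) f u ^+ 2) +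
     (1 - mu) / (h #|tau|.+1)%:R * (\sum_(u in J tau) nbhd_sum tau f u ^+ 2).
Proof.
move=> ct km gap.
have h2 : 0 < (h #|tau|.+2)%:R :> R by rewrite ltr0n h_gt0 //; lia.
rewrite -(ler_pM2l h2) -adj_form_local //.
have /le_trans -> // : \sum_(w in J tau) adj_form (w |: tau) f <=
  \sum_(w in J tau) (h #|tau|.+2)%:R * (mu * (\sum_(u in J (w |: tau)) f u ^+ 2) +
     (1 - mu) * (nbhd_sum tau f w) ^+ 2 / (h #|tau|.+1)%:R).
  apply: ler_sum => w wJ; have cw := cliqueU1 sadj ct wJ.
  have := @link_gap_mean _ mu f cw; rewrite (card_joint_nbhdU1 iadj wJ).
  by apply; [lia | exact: gap].
rewrite -mulr_sumr big_split /= -!mulr_sumr sum_sqr_local //.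
rewrite -mulr_suml -mulr_sumr.
by rewrite le_eqVlt; apply/orP; left; apply/eqP; ring.
Qed.

Lemma adj_form_sqr tau f : clique tau ->
  \sum_(u in J tau) \sum_(v in J (u |: tau)) (f u - f v) ^+ 2 =
  2 * ((h #|tau|.+1)%:R * (\sum_(u in J tau) f u ^+ 2) - adj_form tau f).
Proof.
move=> ct.
transitivity (\sum_(u in J tau) ((h #|tau|.+1)%:R * f u ^+ 2 +
   \sum_(v in J (u |: tau)) f v ^+ 2 - 2 * (f u * nbhd_sum tau f u))).
  apply: eq_bigr => u uJ.
  transitivity (\sum_(v in J (u |: tau)) (f u ^+ 2 + f v ^+ 2 - 2 * f u * f v)).
    by apply: eq_bigr => v _; ring.
  rewrite sumrB big_split /= -[X in _ - X]mulr_sumr -mulrA sumr_const card_J_U1 //.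
  by rewrite -[_ *+ h _]mulr_natl.
rewrite sumrB big_split /= -!mulr_sumr -/(adj_form _ _) sum_sqr_local //.
by ring.
Qed.

Lemma trickle_down tau mu : clique tau -> (#|tau| + 3 <= m)%N -> 0 <= mu < 1 ->
  link_connected tau -> {in J tau, forall w, link_gap (w |: tau) mu} ->
  link_gap tau (mu / (1 - mu)).
Proof.
move=> ct km mu01 conn gap f f0.
have h1 : 0 < (h #|tau|.+1)%:R :> R by rewrite ltr0n h_gt0 //; lia.
have k2 : (#|tau| + 2 <= m)%N by lia.
rewrite mulrAC -ler_pdivrMr // -mxdot_transition //.
have -> : \sum_(u in J tau) f u ^+ 2 = mxdot (row_of (link_vertices adj tau) f) (row_of _ f).
  by rewrite mxdot_J //; apply: eq_bigr => u _; rewrite expr2.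
apply: (trickle_down_form (u := row_of _ (fun=> 1)) (link_transition_sym ct k2) mu01).
- move=> y; have [g ->] := row_of_surj y; rewrite mxdot_transition // row_of_transition //.
  rewrite !mxdot_J // ler_pdivrMr //.
  have := adj_form_local_le g ct km gap; congr (_ <= _).
  rewrite [RHS]mulrDl; congr (_ + _); first by rewrite mulrAC; congr (_ * _ * _).
  rewrite [LHS]mulr_sumr -[RHS]mulrA mulr_suml [RHS]mulr_sumr.
  by apply: eq_bigr => u _; field; rewrite lt0r_neq0.
- move=> y a; have [g ->] := row_of_surj y; rewrite row_of_transition // => ga a1.
  have {}ga : {in J tau, forall u, nbhd_sum tau g u = a * (h #|tau|.+1)%:R * g u}.
    move=> u; rewrite -link_verticesE // => uJ.
    have /rowP/(_ (enum_rank_in uJ u)) := ga; rewrite !mxE enum_rankK_in // => e.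
    by rewrite mulrAC -e divfK // lt0r_neq0.
  (* An eigenvalue at least 1 makes the Dirichlet form nonpositive; as a sum of squares it vanishes
     termwise, so [g] is constant along edges. *)
  have S0 : \sum_(u in J tau) \sum_(v in J (u |: tau)) (g u - g v) ^+ 2 <= 0.
    rewrite adj_form_sqr //.
    have -> : adj_form tau g = a * (h #|tau|.+1)%:R * \sum_(u in J tau) g u ^+ 2.
      by rewrite mulr_sumr; apply: eq_bigr => u uJ; rewrite ga //; ring.
    have : 0 <= \sum_(u in J tau) g u ^+ 2 by apply: sumr_ge0 => u _; apply: sqr_ge0.
    by move=> H; rewrite pmulr_rle0 // subr_le0 -mulrA ler_peMl // mulr_ge0 // ltW.
  have gg : {in J tau &, forall u v, g u = g v}.
    apply: conn => u v uJ vJ uv.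
    have T0 x : 0 <= \sum_(z in J (x |: tau)) (g x - g z) ^+ 2.
      by apply: sumr_ge0 => z _; apply: sqr_ge0.
    have : (g u - g v) ^+ 2 <= 0.
      apply: le_trans S0; rewrite (bigD1 u) //= (bigD1 v) /=; last first.
        by rewrite joint_nbhdU1 uv.
      by rewrite -addrA lerDl addr_ge0 ?sumr_ge0 // => z _; exact: sqr_ge0.
    by rewrite -[_ <= 0]andbT -(sqr_ge0 (g u - g v)) -eq_le sqrf_eq0 subr_eq0 => /eqP.
  case: (set_0Vmem (J tau)) => [J0|[u uJ]].
    exists 0; rewrite scale0r; apply/rowP => i.
    by have := enum_valP i; rewrite {2}link_verticesE // J0 inE.
  exists (g u); apply/rowP => i; rewrite !mxE mulr1; apply: gg => //.
  by rewrite -link_verticesE ?enum_valP.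
- by rewrite mxdot_J // -[RHS]f0; apply: eq_bigr => u _; rewrite mulr1.
Qed.

Lemma link_gap_le tau mu nu : mu <= nu -> link_gap tau mu -> link_gap tau nu.
Proof.
move=> mn gap f f0; apply: (le_trans (gap f f0)).
by rewrite !ler_wpM2r // sumr_ge0 // => u _; exact: sqr_ge0.
Qed.

(** The map [mu / (1 - mu)] sends [1/s] to [1/(s - 1)], so the denominator loses one for each vertex
    removed from [tau]. *)
Lemma link_gap_all t j tau : (m <= t)%N -> (1 < m)%N ->
  (forall tau, clique tau -> (#|tau| + 2 <= m)%N -> link_connected tau) ->
  (forall tau, clique tau -> (#|tau| + 2 = m)%N -> link_gap tau t%:R^-1) ->
  clique tau -> (#|tau| + 2 + j = m)%N -> link_gap tau (t - j)%:R^-1.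
Proof.
move=> mt m1 conn gap; elim: j tau => [|j IH] tau ct km.
  by rewrite subn0; apply: gap => //; rewrite -km addn0.
have tj0 : (t - j)%:R != 0 :> R by rewrite pnatr_eq0; lia.
have tj1 : (t - j.+1)%:R != 0 :> R by rewrite pnatr_eq0; lia.
have tjE : (t - j)%:R = (t - j.+1)%:R + 1 :> R by rewrite natr1; congr (_%:R); lia.
have -> : (t - j.+1)%:R^-1 = (t - j)%:R^-1 / (1 - (t - j)%:R^-1) :> R.
  rewrite tjE in tj0 *; field.
  by rewrite tj0 addrK.
apply: trickle_down => //; first by lia.
- rewrite invr_ge0 ler0n /= invf_lt1 ?ltr0n ?ltr1n; lia.
- by apply: conn => //; lia.
move=> w wJ; apply: IH; first exact: cliqueU1.
by rewrite (card_joint_nbhdU1 iadj wJ); lia.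
Qed.

Lemma local_spectral_expander_of_gap t (lam : R) : (1 < m)%N -> (m <= t)%N ->
  (t - m)%:R^-1 <= lam -> (0 < t - m)%N ->
  (forall tau, clique tau -> (#|tau| + 2 <= m)%N -> link_connected tau) ->
  (forall tau, clique tau -> (#|tau| + 2 = m)%N -> link_gap tau t%:R^-1) ->
  local_spectral_expander adj lam.
Proof.
move=> m1 mt tlam tm conn gap; split; first exact: clique_ext_pure.
move=> tau ct; rewrite clique_numberE => km.
apply: expander_of_gap => //; first by apply: le_trans tlam; rewrite invr_ge0.
have := @link_gap_all t (m - 2 - #|tau|) tau mt m1 conn gap ct.
move=> /(_ ltac:(lia)); apply: link_gap_le; apply: le_trans tlam.
rewrite lef_pV2 ?posrE ?ltr0n ?ler_nat; lia.
Qed.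

End HyperRegular.

(** * Coset complexes *)

(** Orthogonality to constants on a bipartite link only gives that the two sums cancel, while the
    gap is stated for two functions of sum zero. The difference is a function equal to [s/n] on one
    side and [- s/n] on the other, of eigenvalue -1, and discarding it only helps. *)
Lemma sum_gap (R : realFieldType) (T : finType) (H : {set T}) (phi psi : T -> R) (c : R) :
  (0 < #|H|)%N -> 0 <= c ->
  (forall phi' psi' : T -> R, (exists a, forall x, phi' x = phi x - a) ->
    (exists a, forall x, psi' x = psi x - a) ->
    \sum_(x in H) phi' x = 0 -> \sum_(x in H) psi' x = 0 ->
    2 * \sum_(x in H) phi' x * psi' x <=
    c * (\sum_(x in H) phi' x ^+ 2 + \sum_(x in H) psi' x ^+ 2)) ->
  \sum_(x in H) (phi x + psi x) = 0 ->
  2 * \sum_(x in H) phi x * psi x <=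
  c * (\sum_(x in H) phi x ^+ 2 + \sum_(x in H) psi x ^+ 2).
Proof.
move=> H0 c0 HH; rewrite big_split /= => s0.
pose n : R := #|H|%:R; have n0 : 0 < n by rewrite ltr0n.
have n1 : n != 0 by rewrite lt0r_neq0.
pose s := \sum_(x in H) phi x.
have sE : \sum_(x in H) psi x = - s by apply/eqP; rewrite -addr_eq0 addrC s0.
have cH (a : R) : \sum_(x in H) a = a * n by rewrite sumr_const mulr_natr.
have := HH (fun x => phi x - s / n) (fun x => psi x - - (s / n)).
move=> /(_ ltac:(by eexists) ltac:(by eexists)).
rewrite !sumrB !cH sE -/s => /(_ ltac:(by field)) /(_ ltac:(by field)).
have sq (f : T -> R) a : \sum_(x in H) (f x - a) ^+ 2 =
    \sum_(x in H) f x ^+ 2 - 2 * a * \sum_(x in H) f x + a ^+ 2 * n.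
  transitivity (\sum_(x in H) (f x ^+ 2 - 2 * a * f x + a ^+ 2)).
    by apply: eq_bigr => x _; ring.
  by rewrite big_split /= sumrB -mulr_sumr cH.
rewrite !sq sE -/s.
have -> : \sum_(x in H) (phi x - s / n) * (psi x - - (s / n)) =
    \sum_(x in H) phi x * psi x + s ^+ 2 / n.
  transitivity (\sum_(x in H) (phi x * psi x + s / n * phi x - s / n * psi x - (s / n) ^+ 2)).
    by apply: eq_bigr => x _; ring.
  by rewrite !sumrB big_split /= -!mulr_sumr cH sE -/s; field.
set A := \sum_(x in H) _ * _; set B := \sum_(x in H) _; set D := \sum_(x in H) _.
have -> : B - 2 * (s / n) * s + (s / n) ^+ 2 * n +
   (D - 2 * - (s / n) * - s + (- (s / n)) ^+ 2 * n) = B + D - 2 * (s ^+ 2 / n) by field.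
have : 0 <= s ^+ 2 / n by rewrite divr_ge0 ?sqr_ge0 // ltW.
by move: (s ^+ 2 / n) => q q0; rewrite mulrDr mulrBr; nra.
Qed.

Local Open Scope group_scope.

(** Functions on left cosets are read as right-invariant functions on [H], where [x] is an incidence
    between [xA] and [xB]. After rescaling, the inequality bounds by [eps] the cosine of the angle
    between the mean-zero invariant functions of [A] and those of [B]. *)
Definition coset_gap (R : realType) (gT : finGroupType) (H A B : {set gT}) (eps : R) :=
  forall phi psi : gT -> R,
    {in H & A, forall x a, phi (x * a) = phi x} ->
    {in H & B, forall x b, psi (x * b) = psi x} ->
    (\sum_(x in H) phi x = 0 -> \sum_(x in H) psi x = 0 ->
    2 * \sum_(x in H) phi x * psi x <=
    eps * (\sum_(x in H) phi x ^+ 2 + \sum_(x in H) psi x ^+ 2))%R.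

(** In [cfam_flag] the cosets of 1 under [K (i |: S)] and [K (j |: S)] and the coset of [x] under
    [K (l |: S)] meet pairwise, at 1, [x] and [x * z]; the element [y] is common to all three.
    [cfam_gen] yields connected links, and [cfam_gap] the starting bound for trickling down. *)
Record coset_family (R : realType) (gT : finGroupType) m
    (K : {set 'I_m} -> {group gT}) (eps : R) : Prop := CosetFamily {
  cfam_meet : forall S T, K (S :|: T) = K S :&: K T :> {set gT};
  cfam_full : K setT = 1 :> {set gT};
  cfam_flag : forall S i j l x z, i != j -> j != l -> i != l ->
    x \in K (i |: S) -> z \in K (l |: S) -> x * z \in K (j |: S) ->
    exists2 y, y \in K (i |: (j |: S)) & y^-1 * x \in K (l |: (i |: S));
  cfam_gen : forall S : {set 'I_m}, (#|S| + 2 <= m)%N ->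
    K S \subset <<\bigcup_(l in ~: S) K (l |: S)>>;
  cfam_gap : forall (S : {set 'I_m}) i j, i != j -> S = ~: [set i; j] ->
    coset_gap (K S) (K (i |: S)) (K (j |: S)) eps }.

Section CosetGraph.
Variables (R : realType) (gT : finGroupType) (m : nat) (K : {set 'I_m} -> {group gT}).
Variables (eps : R) (i0 : 'I_m).
Hypothesis famK : coset_family K eps.
Implicit Types (S T : {set 'I_m}) (i j l : 'I_m) (g x y z : gT).

Lemma cfam_setU1 S i x : (x \in K (i |: S)) = (x \in K [set i]) && (x \in K S).
Proof. by rewrite (cfam_meet famK) inE. Qed.

Lemma cfam_sub S T : S \subset T -> K T \subset K S.
Proof. by move=> /setUidPr <-; rewrite (cfam_meet famK) subsetIl. Qed.

Lemma mem_cfam S x :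
  x \in K S <-> x \in K set0 /\ {in S, forall i, x \in K [set i]}.
Proof.
split=> [xS|[x0 xS]].
  split=> [|i iS]; first exact: (subsetP (cfam_sub (sub0set S))).
  by apply: (subsetP (cfam_sub _)) xS; rewrite sub1set.
move: xS; have [k] := ubnP #|S|; elim: k S => // k IH S Sk xS.
have [->//|[i iS]] := set_0Vmem S.
rewrite -(setD1K iS) cfam_setU1 xS // IH //; last by move=> j /setD1P[_ /xS].
by move: Sk; rewrite (cardsD1 i) iS.
Qed.

(* Induction on [T]: fix one coset and use [cfam_flag] to make the others meet
   pairwise inside it. *)
Lemma cfam_helly S T (r : 'I_m -> gT) :
  {in T, forall i, r i \in K S} ->
  {in T &, forall i j, i != j -> exists2 x, x \in K S &
     (r i)^-1 * x \in K (i |: S) /\ (r j)^-1 * x \in K (j |: S)} ->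
  exists2 x, x \in K S & {in T, forall i, (r i)^-1 * x \in K (i |: S)}.
Proof.
have [k] := ubnP #|T|; elim: k S T r => // k IH S T r Tk rS rT.
have [->|[t tT]] := set_0Vmem T; first by exists 1 => // i; rewrite inE.
pose T' := T :\ t.
have /fin_all_exists[w wP] i : exists x, i \in T' ->
    [/\ x \in K S, (r t)^-1 * x \in K (t |: S) & (r i)^-1 * x \in K (i |: S)].
  case: (boolP (i \in T')) => [/setD1P[it iT]|]; last by exists 1.
  by have [|x xS [? ?]] := rT t i tT iT; [rewrite eq_sym | exists x].
have [||| x xt xT] := IH (t |: S) T' (fun i => (r t)^-1 * w i).
- by move: Tk; rewrite (cardsD1 t) tT.
- by move=> i /wP[].
- move=> i j iT' jT' ij.
  have [wiS wit wii] := wP _ iT'; have [wjS wjt wjj] := wP _ jT'.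
  have /setD1P[it iT] := iT'; have /setD1P[jt jT] := jT'.
  have [y yS [yi yj]] := rT i j iT jT ij.
  have wyi : (w i)^-1 * y \in K (i |: S).
    have -> : (w i)^-1 * y = ((r i)^-1 * w i)^-1 * ((r i)^-1 * y) by rewrite invMg invgK !mulgA mulgK.
    by rewrite groupM ?groupV.
  have wyj : y^-1 * w j \in K (j |: S).
    have -> : y^-1 * w j = ((r j)^-1 * y)^-1 * ((r j)^-1 * w j) by rewrite invMg invgK !mulgA mulgK.
    by rewrite groupM ?groupV.
  have wij : (w i)^-1 * w j \in K (t |: S).
    have -> : (w i)^-1 * w j = ((r t)^-1 * w i)^-1 * ((r t)^-1 * w j) by rewrite invMg invgK !mulgA mulgK.
    by rewrite groupM ?groupV.
  have [||||v vit vij] := cfam_flag famK (i := i) (j := t) (l := j) _ _ _ wyi wyj.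
  + by [].
  + by rewrite eq_sym.
  + by [].
  + by rewrite mulgA mulgK.
  have vt : v \in K (t |: S) by move: vit; rewrite cfam_setU1 => /andP[].
  exists ((r t)^-1 * (w i * v)).
    by rewrite mulgA groupM.
  rewrite !invMg !invgK -!mulgA !mulKVg mulKg; split=> //.
  rewrite cfam_setU1 cfam_setU1; apply/and3P; split.
  + have : y^-1 * w j \in K [set j] by move: wyj; rewrite cfam_setU1 => /andP[].
    have : v^-1 * ((w i)^-1 * y) \in K [set j] by move: vij; rewrite cfam_setU1 => /andP[].
    move=> a b; have := groupM a b; rewrite -groupV.
    by rewrite -!mulgA mulKVg !invMg !invgK mulgA.
  + have := vt; have := wij; rewrite !cfam_setU1 => /andP[a _] /andP[b _].
    have -> : (w j)^-1 * (w i * v) = ((w i)^-1 * w j)^-1 * v by rewrite invMg invgK mulgA.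
    by rewrite groupM ?groupV.
  + have := vt; have := wij; rewrite !cfam_setU1 => /andP[_ a] /andP[_ b].
    have -> : (w j)^-1 * (w i * v) = ((w i)^-1 * w j)^-1 * v by rewrite invMg invgK mulgA.
    by rewrite groupM ?groupV.
exists (r t * x).
  by rewrite groupM ?rS //; move: xt; rewrite cfam_setU1 => /andP[].
move=> i iT; case: (eqVneq i t) => [->|it]; first by rewrite mulKg.
have iT' : i \in T' by rewrite !inE it.
have [wiS wit wii] := wP _ iT'.
have := xT i iT'; rewrite setUCA cfam_setU1 invMg invgK -mulgA => /andP[_ e].
have -> : (r i)^-1 * (r t * x) = (r i)^-1 * w i * ((w i)^-1 * (r t * x)).
  by rewrite !mulgA mulgK.
by rewrite groupM // -mulgA.
Qed.

(** The type is stored with the coset, so that equal subsets arising from different subgroups remain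
    different vertices. *)
Definition cg_cosets : {set 'I_m * {set gT}} :=
  [set (i, g *: K [set i]) | i in 'I_m, g in K set0].

Lemma cg_cosets0 : (i0, 1 *: K [set i0]) \in cg_cosets.
Proof. by apply/imset2P; exists i0 1. Qed.

Definition cg_size := #|cg_cosets|.

(** A default vertex is returned when [g] lies outside [K set0], hence the membership hypotheses
    below. *)
Definition vtx g i : 'I_cg_size := enum_rank_in cg_cosets0 (i, g *: K [set i]).

Definition vtype (u : 'I_cg_size) : 'I_m := (enum_val u).1.

Definition cg_adj : rel 'I_cg_size := fun u v =>
  (vtype u != vtype v) && ((enum_val u).2 :&: (enum_val v).2 != set0).

Implicit Types (u v : 'I_cg_size).

Lemma vtxK g i : g \in K set0 -> enum_val (vtx g i) = (i, g *: K [set i]).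
Proof. by move=> gG; rewrite enum_rankK_in //; apply/imset2P; exists i g. Qed.

Lemma vtype_vtx g i : g \in K set0 -> vtype (vtx g i) = i.
Proof. by move=> gG; rewrite /vtype vtxK. Qed.

Lemma vtx_surj u : exists2 g, g \in K set0 & u = vtx g (vtype u).
Proof.
have /imset2P[i g _ gG e] := enum_valP u; exists g => //.
by apply: enum_val_inj; rewrite vtxK // /vtype e.
Qed.

Lemma eq_vtx g x i : g \in K set0 -> x \in K set0 ->
  (vtx g i == vtx x i) = (g^-1 * x \in K [set i]).
Proof.
move=> gG xG; rewrite -(inj_eq enum_val_inj) !vtxK // xpair_eqE eqxx /=.
rewrite -mem_lcoset; by apply/eqP/lcoset_eqP => /esym.
Qed.

Lemma cg_adjP g x i j : g \in K set0 -> x \in K set0 ->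
  reflect (i != j /\ exists2 y, y \in K set0 & g^-1 * y \in K [set i] /\ x^-1 * y \in K [set j])
    (cg_adj (vtx g i) (vtx x j)).
Proof.
move=> gG xG; rewrite /cg_adj !vtype_vtx // !vtxK //=.
apply: (iffP andP) => [[ij /set0Pn[y /setIP[]]]|[ij [y yG [gy xy]]]].
  rewrite !mem_lcoset => gy xy; split=> //; exists y => //.
  by rewrite -(mulKVg g y) groupM //; apply: (subsetP (cfam_sub (sub0set _))) gy.
by split=> //; apply/set0Pn; exists y; rewrite inE !mem_lcoset gy xy.
Qed.

Lemma cg_adj_vtx g i j : g \in K set0 -> cg_adj (vtx g i) (vtx g j) = (i != j).
Proof.
move=> gG; apply/cg_adjP/idP => // [[]//|ij]; split=> //; exists g => //.
by rewrite mulVg !group1.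
Qed.

Lemma cg_sym : symmetric cg_adj.
Proof. by move=> u v; rewrite /cg_adj eq_sym setIC. Qed.

Lemma cg_irr : irreflexive cg_adj.
Proof. by move=> u; rewrite /cg_adj eqxx. Qed.

Local Notation J := (joint_nbhd cg_adj).
Local Notation clique := (is_clique cg_adj).

Definition face g S := [set vtx g i | i in S].

Lemma face_clique g S : g \in K set0 -> clique (face g S).
Proof.
move=> gG; apply/cliqueP => u v /imsetP[i _ ->] /imsetP[j _ ->] uv.
by rewrite cg_adj_vtx //; apply: contraNneq uv => ->.
Qed.

Lemma card_face g S : g \in K set0 -> #|face g S| = #|S|.
Proof.
move=> gG; apply: card_in_imset => i j _ _ e.
by rewrite -(vtype_vtx i gG) e vtype_vtx.
Qed.

Lemma faceU1 g i S : vtx g i |: face g S = face g (i |: S).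
Proof. by rewrite /face imsetU imset_set1. Qed.

(** Flagness: adjacent vertices are cosets that meet, and [cfam_helly] turns pairwise intersection
    into a common element. All counting in links can then take place in the group. *)
Lemma clique_face C : clique C -> exists2 g, g \in K set0 & C = face g (vtype @: C).
Proof.
move=> /cliqueP cC.
have /fin_all_exists[r rP] i : exists g, g \in K set0 /\ (i \in vtype @: C -> vtx g i \in C).
  case: (boolP (i \in vtype @: C)) => [/imsetP[u uC ->]|_]; last by exists 1.
  by have [g gG e] := vtx_surj u; exists g; rewrite -e.
have [|x xG xP] := @cfam_helly set0 (vtype @: C) r (fun i _ => (rP i).1).
  move=> i j iC jC ij; rewrite !setU0; have [riG ri] := rP i; have [rjG rj] := rP j.
  have : cg_adj (vtx (r i) i) (vtx (r j) j).
    apply: cC; rewrite ?ri ?rj //; apply: contraNneq ij => /(congr1 vtype).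
    by rewrite !vtype_vtx // => ->.
  by case/cg_adjP => // _ [y yG []]; exists y.
have rx i : i \in vtype @: C -> vtx (r i) i = vtx x i.
  by move=> iC; apply/eqP; rewrite eq_vtx ?(rP i).1 //; have := xP i iC; rewrite setU0.
exists x => //; apply/setP => u; apply/idP/imsetP => [uC|[i iC ->]]; last first.
  by rewrite -rx //; apply: (rP i).2.
exists (vtype u); first exact: imset_f.
rewrite -rx ?imset_f //; apply/eqP; apply: contraT => ne.
have := cC _ _ uC ((rP _).2 (imset_f _ uC)) ne.
by rewrite /cg_adj vtype_vtx ?eqxx ?(rP _).1.
Qed.

Lemma clique_leq C : clique C -> (#|C| <= m)%N.
Proof.
move=> /clique_face[g gG ->]; rewrite card_face //.
by rewrite -[X in (_ <= X)%N]card_ord max_card.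
Qed.

Lemma clique_extends C : clique C -> exists C', [&& clique C', C \subset C' & #|C'| == m].
Proof.
move=> /clique_face[g gG ->]; exists (face g setT).
by rewrite face_clique // imsetS ?subsetT // card_face // cardsT card_ord eqxx.
Qed.

(** The link of a face is, up to translation by [g], the coset complex of [K S] with respect to the
    subgroups [K (l |: S)]. *)
Lemma mem_J_face g S u : g \in K set0 ->
  reflect (exists x l, [/\ x \in K S, l \notin S & u = vtx (g * x) l]) (u \in J (face g S)).
Proof.
move=> gG; apply: (iffP idP) => [uJ|[x [l [xS lS ->]]]]; last first.
  have [xG xi] := (mem_cfam _ _).1 xS; have gxG : g * x \in K set0 by rewrite groupM.
  apply/joint_nbhdP => v /imsetP[i iS ->].
  have -> : vtx g i = vtx (g * x) i by apply/eqP; rewrite eq_vtx // mulKg xi.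
  by rewrite cg_adj_vtx //; apply: contraNneq lS => <-.
have [y yG e] := clique_face (cliqueU1 cg_sym (face_clique S gG) uJ).
have uE : u = vtx y (vtype u).
  have : u \in u |: face g S by rewrite setU11.
  by rewrite {1}e => /imsetP[l _ ->]; rewrite vtype_vtx.
exists (g^-1 * y), (vtype u); rewrite mulKVg; split=> //.
  apply/mem_cfam; split; first by rewrite groupM ?groupV.
  move=> i iS; have : vtx g i \in u |: face g S by rewrite setU1r // imset_f.
  rewrite {1}e => /imsetP[l _ gl]; have il : i = l by rewrite -(vtype_vtx i gG) gl vtype_vtx.
  by rewrite -eq_vtx // gl il.
apply/negP => uS; have /joint_nbhdP/(_ _ (imset_f (vtx g) uS)) := uJ.
by rewrite /cg_adj vtype_vtx // eqxx.
Qed.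

Lemma sum_vtx (V : nmodType) (F : 'I_cg_size -> V) g S l : g \in K set0 -> l \notin S ->
  (\sum_(x in K S) F (vtx (g * x) l) =
   \sum_(u in J (face g S) | vtype u == l) F u *+ #|K (l |: S)|)%R.
Proof.
move=> gG lS; rewrite (partition_big (fun x => vtx (g * x) l)
   [pred u | (u \in J (face g S)) && (vtype u == l)]) /=; last first.
  move=> x xS; have [xG _] := (mem_cfam _ _).1 xS.
  rewrite vtype_vtx ?groupM // eqxx andbT; apply/mem_J_face => //.
  by exists x, l.
apply: eq_bigr => u /andP[/mem_J_face[//|x [l' [xS l'S ->]]]].
have [xG _] := (mem_cfam _ _).1 xS; rewrite vtype_vtx ?groupM // => /eqP ->.
rewrite (eq_bigr (fun=> F (vtx (g * x) l))) => [|y /andP[_ /eqP ->] //].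
rewrite sumr_const -(card_lcoset _ x); congr (_ *+ _)%R; apply: eq_card => y.
rewrite [LHS]inE mem_lcoset cfam_setU1 /= andbC.
case: (boolP (y \in K S)) => yS; last first.
  rewrite andbF; apply/esym/negP => /andP[_ xyS]; case/negP: yS.
  by rewrite -(mulKVg x y) groupM.
have [yG _] := (mem_cfam _ _).1 yS.
have -> : x^-1 * y \in K S by rewrite groupM ?groupV.
rewrite [LHS]andbT [RHS]andbT eq_sym eq_vtx ?(groupM gG) //.
by rewrite invMg -mulgA mulKg.
Qed.

Variable M : nat -> nat.
Hypothesis cardK : forall S : {set 'I_m}, #|K S| = M #|S|.

(** The link of a face of size [k] has [m - k] remaining types, and each contributes as many
    vertices as the index of [K (l |: S)] in [K S]. For positive [k] the order [M 0] of the whole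
    group does not enter. *)
Definition cg_degree k := ((m - k) * M k %/ M k.+1)%N.

Lemma sum_J (V : nmodType) (F : 'I_cg_size -> V) g S : g \in K set0 ->
  ((\sum_(u in J (face g S)) F u) *+ M #|S|.+1 =
   \sum_(l in ~: S) \sum_(x in K S) F (vtx (g * x) l))%R.
Proof.
move=> gG; rewrite (partition_big vtype (mem (~: S))) /=; last first.
  move=> u /mem_J_face[//|x [l [xS lS ->]]]; have [xG _] := (mem_cfam _ _).1 xS.
  by rewrite vtype_vtx ?groupM // inE.
rewrite -sumrMnl; apply: eq_bigr => l; rewrite inE => lS.
by rewrite sum_vtx // cardK cardsU1 lS sumrMnl.
Qed.

Lemma M_gt0 S : (0 < M #|S|)%N.
Proof. by rewrite -cardK cardG_gt0. Qed.

Lemma ex_card_set k : (k <= m)%N -> exists S : {set 'I_m}, #|S| = k.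
Proof.
move=> km; exists [set x in take k (enum 'I_m)].
rewrite cardsE (card_uniqP _) ?take_uniq ?enum_uniq // size_take -cardE card_ord.
by case: ltngtP km => // ->.
Qed.

Lemma card_J_face g S : g \in K set0 -> #|J (face g S)| = cg_degree #|S|.
Proof.
move=> gG; rewrite /cg_degree.
have : (#|J (face g S)| * M #|S|.+1 = (m - #|S|) * M #|S|)%N.
  apply/eqP; rewrite -(eqr_nat R) !natrM -!sumr_const mulr_natr sum_J //.
  rewrite (eq_bigr (fun=> (M #|S|)%:R)%R) => [|l _]; last first.
    by rewrite sumr_const cardK.
  by rewrite !sumr_const (cardsCs (~: S)) setCK card_ord mulr_natl.
have [Sm|] := ltnP #|S| m.
  have [l lS] : exists l, l \in ~: S.
    by apply/set0Pn; rewrite -card_gt0 (cardsCs (~: S)) setCK card_ord subn_gt0.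
  rewrite inE in lS; have := M_gt0 (l |: S); rewrite cardsU1 lS add1n => M0.
  by move=> <-; rewrite mulnK.
move=> mS _; have ST : S = setT.
  by apply/eqP; rewrite eqEcard subsetT cardsT card_ord mS.
rewrite ST cardsT card_ord subnn mul0n div0n; apply: eq_card0 => u.
by apply/negP => /mem_J_face[//|x [l []]]; rewrite inE.
Qed.

Lemma card_J_clique C : clique C -> #|J C| = cg_degree #|C|.
Proof. by move=> /clique_face[g gG ->]; rewrite card_J_face // card_face. Qed.

Lemma J_face_neq0 g S : g \in K set0 -> (#|S| < m)%N -> exists u, u \in J (face g S).
Proof.
move=> gG Sm; have [l lS] : exists l, l \in ~: S.
  by apply/set0Pn; rewrite -card_gt0 (cardsCs (~: S)) setCK card_ord subn_gt0.
by exists (vtx (g * 1) l); apply/mem_J_face => //; exists 1, l; rewrite group1 -in_setC.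
Qed.

Lemma cg_degree_gt0 k : (0 < k < m)%N -> (0 < cg_degree k)%N.
Proof.
case/andP => _ km; have [S Sk] := ex_card_set (ltnW km).
have [|u uJ] := @J_face_neq0 1 S (group1 _); first by rewrite Sk.
by rewrite -Sk -(card_J_face S (group1 _)) card_gt0; apply/set0Pn; exists u.
Qed.

Lemma cg_degree_decr k : (k < m)%N -> (cg_degree k.+1 < cg_degree k)%N.
Proof.
move=> km; have [S Sk] := ex_card_set (ltnW km).
have [|u uJ] := @J_face_neq0 1 S (group1 _); first by rewrite Sk.
have cS := face_clique S (group1 (K set0)); have cuS := cliqueU1 cg_sym cS uJ.
rewrite -Sk -(card_face S (group1 _)) -(card_joint_nbhdU1 cg_irr uJ) -!card_J_clique //.
apply: proper_card; apply/properP; split.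
  by apply/subsetP => v; rewrite joint_nbhdU1 => /andP[].
by exists u => //; rewrite joint_nbhdU1 cg_irr.
Qed.

(** The index shifts by one because the valency in the link of a [k]-clique is the number of
    vertices in the link of a [k.+1]-clique. *)
Lemma cg_regular n : regular_seq cg_adj n (fun k => cg_degree k.+1).
Proof.
split=> [v|k _ C cC Ck v vJ].
  have -> : [set u | cg_adj v u] = J [set v].
    apply/setP => u; rewrite inE; apply/idP/joint_nbhdP => [vu w /set1P ->//|].
    by apply; rewrite set11.
  rewrite card_J_clique ?cards1 //; apply/cliqueP => u w /set1P -> /set1P ->.
  by rewrite eqxx.
have -> : [set u in J C | cg_adj v u] = J (v |: C).
  by apply/setP => u; rewrite inE joint_nbhdU1 andbC.
by rewrite card_J_clique ?(card_joint_nbhdU1 cg_irr vJ) ?Ck //; exact: (cliqueU1 cg_sym).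
Qed.

(** The vertices of type [i0] alone are the cosets of a subgroup of order [M 1]. *)
Lemma cg_size_ge : (#|K set0| <= cg_size * M 1)%N.
Proof.
rewrite -(ler_nat R) -sumr_const (@sum_vtx _ (fun=> 1%R) 1 set0 i0) ?inE //.
rewrite cardK cardsU1 inE cards0 addn0 sumrMnl sumr_const natrM mulr_natr.
by rewrite ler_wMn2r // ler_nat -[leqRHS]card_ord max_card.
Qed.

Lemma cg_connected tau : clique tau -> (#|tau| + 2 <= m)%N ->
  link_connected R cg_adj tau.
Proof.
move=> /clique_face[g gG ->]; set S := vtype @: tau; rewrite card_face // => Sm f fJ.
have inJ x l : x \in K S -> l \notin S -> vtx (g * x) l \in J (face g S).
  by move=> xS lS; apply/mem_J_face => //; exists x, l.
have same x l l' : x \in K S -> l \notin S -> l' \notin S ->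
    f (vtx (g * x) l) = f (vtx (g * x) l').
  move=> xS lS l'S; have [xG _] := (mem_cfam _ _).1 xS.
  case: (eqVneq l l') => [->//|ll']; apply: fJ; rewrite ?inJ //.
  by rewrite cg_adj_vtx // groupM.
(* [P] collects the right translations that preserve [f], and is a subgroup. It contains
   [K (l |: S)]: pass to type [l], where [x] and [x * z] give the same vertex. Generation then makes
   it all of [K S]. *)
pose P := [set z in K S | [forall x in K S, forall l in ~: S, f (vtx (g * (x * z)) l) == f (vtx (g * x) l)]].
have PP z : reflect (z \in K S /\ {in K S & ~: S, forall x l, f (vtx (g * (x * z)) l) = f (vtx (g * x) l)}) (z \in P).
  rewrite inE; apply: (iffP andP) => [[zS /forall_inP zP]|[zS zP]]; split=> //.
    by move=> x l xS lS; have /forall_inP/(_ l lS)/eqP := zP x xS.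
  by apply/forall_inP => x xS; apply/forall_inP => l lS; rewrite zP.
have gP : group_set P.
  apply/group_setP; split=> [|y z /PP[yS yP] /PP[zS zP]]; apply/PP; split.
  - exact: group1.
  - by move=> x l _ _; rewrite mulg1.
  - exact: groupM.
  - by move=> x l xS lS; rewrite (mulgA x) zP ?groupM // yP.
have sub : K S \subset P.
  apply: subset_trans (cfam_gen famK Sm) _; rewrite -[P]/(gval (Group gP)) gen_subG.
  apply/bigcupsP => l lS; apply/subsetP => z zl; apply/PP.
  have zS : z \in K S by move: zl; rewrite cfam_setU1 => /andP[].
  split=> // x l' xS l'S; rewrite !inE in lS l'S.
  rewrite (same _ l' l) ?groupM // (same x l' l) //; congr f; apply/eqP.
  have [xG _] := (mem_cfam _ _).1 xS; have [zG _] := (mem_cfam _ _).1 zS.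
  have xzG := groupM xG zG; rewrite eq_sym eq_vtx ?(groupM gG) // invMg -mulgA !mulKg.
  by move: zl; rewrite cfam_setU1 => /andP[].
move=> u v /mem_J_face[//|x [l [xS lS ->]]] /mem_J_face[//|y [l' [yS l'S ->]]].
rewrite (same y l' l) //.
have xyP : x^-1 * y \in P by apply: (subsetP sub); rewrite groupM ?groupV.
have [_ H] := PP _ xyP; rewrite -[in RHS](mulKVg x y) H ?inE //.
Qed.

Lemma M_full : M m = 1%N.
Proof. by have := cardK setT; rewrite cardsT card_ord (cfam_full famK) cards1. Qed.

Lemma card_setC_eq (T : finType) (S : {set T}) k n :
  #|T| = n -> (#|S| + k = n)%N -> #|~: S| = k.
Proof. by move=> <- e; rewrite cardsCs setCK -e addKn. Qed.

(** The subgroup indexed by all of ['I_m] is trivial, so the elements of [K S] are exactly the edges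
    of this bipartite link and sums over edges become sums over the group. *)
Lemma cg_gap tau : (0 <= eps)%R -> clique tau -> (#|tau| + 2 = m)%N ->
  link_gap cg_adj cg_degree tau eps.
Proof.
move=> eps0 /clique_face[g gG ->]; move: (vtype @: tau) => S; rewrite card_face // => Sm.
have [i [j [ij SE]]] : exists i j, (i != j) /\ S = ~: [set i; j].
  have /eqP/cards2P[i [j [ij e]]] : #|~: S| = 2.
    exact: card_setC_eq (card_ord m) Sm.
  by exists i, j; rewrite -e setCK; split.
have sumS (V : nmodType) (F : 'I_m -> V) : (\sum_(l in ~: S) F l = F i + F j)%R.
  by rewrite SE setCK big_setU1 ?inE ?big_set1.
have M2 : M #|S|.+2 = 1%N by rewrite -addn2 Sm M_full.
set M1 := M #|S|.+1; have degE : cg_degree #|S|.+1 = M1.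
  by rewrite /cg_degree M2 divn1 -{1}Sm addn2 subSnn mul1n.
have [iS jS] : i \notin S /\ j \notin S by rewrite SE !inE !eqxx orbT.
have Ki : #|K (i |: S)| = M1 by rewrite cardK cardsU1 iS.
have Kj : #|K (j |: S)| = M1 by rewrite cardK cardsU1 jS.
have M10 : (M1%:R != 0 :> R)%R by rewrite -Ki pnatr_eq0 -lt0n cardG_gt0.
move=> f f0; rewrite card_face // degE.
pose phi x := f (vtx (g * x) i); pose psi x := f (vtx (g * x) j).
have SJ (F : 'I_cg_size -> R) : (M1%:R * \sum_(u in J (face g S)) F u =
    \sum_(x in K S) (F (vtx (g * x) i) + F (vtx (g * x) j)))%R.
  by rewrite mulr_natl sum_J // sumS big_split.
have KSG x : x \in K S -> g * x \in K set0.
  by move=> /mem_cfam[xG _]; rewrite groupM.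
have KU l x : x \in K (l |: S) -> x \in K S by rewrite cfam_setU1 => /andP[].
have inv l x y : x \in K S -> y \in K (l |: S) -> vtx (g * (x * y)) l = vtx (g * x) l.
  move=> xS yl; have xyS := groupM xS (KU _ _ yl); apply/eqP; rewrite eq_sym eq_vtx ?KSG //.
  by move: yl; rewrite invMg -mulgA !mulKg cfam_setU1 => /andP[].
have nbhd l l' x : l \notin S -> l' \notin S -> l != l' -> x \in K S ->
    nbhd_sum cg_adj (face g S) f (vtx (g * x) l) =
    (\sum_(y in K (l |: S)) f (vtx (g * (x * y)) l'))%R.
  move=> lS l'S ll' xS; rewrite /nbhd_sum.
  have -> : vtx (g * x) l |: face g S = face (g * x) (l |: S).
    rewrite -faceU1; congr (_ |: _); apply: eq_in_imset => k kS.
    by apply/eqP; rewrite eq_vtx ?KSG // mulKg; have [_ ->] := (mem_cfam _ _).1 xS.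
  have := sum_J f (l |: S) (KSG _ xS).
  rewrite cardsU1 lS add1n M2 mulr1n => ->.
  have -> : ~: (l |: S) = [set l'].
    apply/eqP; rewrite eq_sym eqEcard sub1set !inE eq_sym (negPf ll') l'S cards1.
    by rewrite (card_setC_eq (k := 1) (card_ord m)) // cardsU1 lS add1n addn1 -addn2.
  by rewrite big_set1; apply: eq_bigr => y _; rewrite mulgA.
have adjE : adj_form cg_adj (face g S) f = (2 * \sum_(x in K S) phi x * psi x)%R.
  apply: (mulfI M10); rewrite /adj_form SJ.
  have half l l' : l \notin S -> l' \notin S -> l != l' -> #|K (l |: S)| = M1 ->
      (\sum_(x in K S) f (vtx (g * x) l) * nbhd_sum cg_adj (face g S) f (vtx (g * x) l) =
       M1%:R * \sum_(x in K S) f (vtx (g * x) l) * f (vtx (g * x) l'))%R.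
    move=> lS l'S ll' cl.
    (* Right translation by [y] fixes the first factor, so both factors can be evaluated at [x * y],
       which then becomes the summation variable. *)
    transitivity (\sum_(x in K S) \sum_(y in K (l |: S))
        (f (vtx (g * (x * y)) l) * f (vtx (g * (x * y)) l')))%R.
      apply: eq_bigr => x xS; rewrite (nbhd l l') // mulr_sumr.
      by apply: eq_bigr => y yl; rewrite [in RHS](inv l).
    rewrite exchange_big /= mulr_natl -cl -sumr_const; apply: eq_bigr => y yl.
    rewrite [RHS](reindex_inj (mulIg y)) /=; apply: eq_bigl => x.
    by rewrite groupMr // (KU l).
  rewrite big_split /= (half i j) // (half j i) // 1?eq_sym // -mulrDr; congr (_ * _)%R.
  rewrite mulr_natl mulr2n; congr (_ + _)%R.
  by apply: eq_bigr => x _; rewrite mulrC.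
rewrite adjE -mulrA SJ big_split /=.
apply: sum_gap; rewrite ?cardG_gt0 //.
  move=> phi' psi' [a phiE] [b psiE]; apply: (cfam_gap famK ij SE) => x y xS yl.
    by rewrite !phiE /phi inv.
  by rewrite !psiE /psi inv.
by rewrite -SJ f0 mulr0.
Qed.

Theorem cg_local_spectral_expander t (lam : R) : eps = (t%:R^-1)%R -> (1 < m)%N ->
  (m < t)%N -> ((t - m)%:R^-1 <= lam)%R -> local_spectral_expander cg_adj lam.
Proof.
move=> epsE m1 mt tlam.
apply: (@local_spectral_expander_of_gap R _ cg_adj m cg_degree cg_sym cg_irr _ _ _ _ t) => //.
- by move=> C cC _; exact: card_J_clique.
- exact: cg_degree_gt0.
- exact: clique_leq.
- exact: clique_extends.
- exact: ltnW.
- by rewrite subn_gt0.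
- exact: cg_connected.
- by move=> tau ct tm; rewrite -epsE; apply: cg_gap; rewrite // epsE invr_ge0.
Qed.

End CosetGraph.

(** * Products of coset families *)

(** Split each function into its average over [H2] and the rest. The two parts are orthogonal; the
    gap of the first factor controls the averages, and that of the second controls the rest, which
    sums to zero on every fibre. *)
Lemma coset_gap_prod (R : realType) (gT1 gT2 : finGroupType)
  (H1 A1 B1 : {group gT1}) (H2 A2 B2 : {group gT2}) (eps : R) :
  A1 \subset H1 -> B1 \subset H1 -> A2 \subset H2 -> B2 \subset H2 ->
  coset_gap H1 A1 B1 eps -> coset_gap H2 A2 B2 eps ->
  coset_gap (setX H1 H2) (setX A1 A2) (setX B1 B2) eps.
Proof.
move=> sA1 sB1 sA2 sB2 gap1 gap2 phi psi phiA psiB.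
have H2_0 : (#|H2|%:R != 0 :> R)%R by rewrite pnatr_eq0 -lt0n cardG_gt0.
set n : R := (#|H2|%:R)%R in H2_0.
have sumX (V : nmodType) (F : gT1 * gT2 -> V) :
    (\sum_(z in setX H1 H2) F z = \sum_(x in H1) \sum_(y in H2) F (x, y))%R.
  rewrite pair_big /=; apply: eq_big => [[x y]|[x y] _ //]; by rewrite inE.
pose avg (f : gT1 * gT2 -> R) x : R := ((\sum_(y in H2) f (x, y)) / n)%R.
have cH (a : R) : (\sum_(y in H2) a = a * n)%R by rewrite sumr_const mulr_natr.
have avg0 f x : (\sum_(y in H2) (f (x, y) - avg f x) = 0)%R.
  by rewrite sumrB cH divfK // subrr.
have split_sum f f' : (\sum_(z in setX H1 H2) f z * f' z =
    n * (\sum_(x in H1) avg f x * avg f' x) + 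
    \sum_(x in H1) \sum_(y in H2) (f (x, y) - avg f x) * (f' (x, y) - avg f' x))%R.
  rewrite sumX mulr_sumr -big_split /=; apply: eq_bigr => x xH.
  transitivity (\sum_(y in H2) (avg f x * avg f' x + (avg f x * (f' (x, y) - avg f' x) +
     avg f' x * (f (x, y) - avg f x)) + (f (x, y) - avg f x) * (f' (x, y) - avg f' x)))%R.
    by apply: eq_bigr => y _; ring.
  rewrite !big_split /= -!mulr_sumr !avg0 !mulr0 !addr0 cH.
  by congr (_ + _)%R; rewrite /avg; field.
have avg_sum f : (\sum_(z in setX H1 H2) f z = 0 -> \sum_(x in H1) avg f x = 0)%R.
  by move=> f0; rewrite -mulr_suml -sumX f0 mul0r.
have avg_inv f (A : {group gT1}) (B : {group gT2}) : 
    {in setX H1 H2 & setX A B, forall x a, f (x * a) = f x} ->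
    {in H1 & A, forall x a, avg f (x * a) = avg f x}.
  move=> fi x a xH aA; congr (_ / _)%R; apply: eq_bigr => y yH.
  have := fi (x, y) (a, 1); rewrite !inE xH yH aA group1 => /(_ isT isT) <-.
  by congr f; rewrite -[RHS]/(x * a, y * 1) mulg1.
move=> phi0 psi0.
have sq (f : gT1 * gT2 -> R) : (\sum_(z in setX H1 H2) f z ^+ 2 = n * (\sum_(x in H1) avg f x ^+ 2) +
    \sum_(x in H1) \sum_(y in H2) (f (x, y) - avg f x) ^+ 2)%R.
  exact: (split_sum f f).
rewrite split_sum !sq.
have g1 := gap1 _ _ (avg_inv _ _ _ phiA) (avg_inv _ _ _ psiB) (avg_sum _ phi0) (avg_sum _ psi0).
have g2 : (2 * (\sum_(x in H1) \sum_(y in H2) (phi (x, y) - avg phi x) * (psi (x, y) - avg psi x)) <=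
  eps * (\sum_(x in H1) \sum_(y in H2) (phi (x, y) - avg phi x) ^+ 2 +
     \sum_(x in H1) \sum_(y in H2) (psi (x, y) - avg psi x) ^+ 2))%R.
  rewrite -big_split /= !mulr_sumr; apply: ler_sum => x xH.
  apply: (gap2 (fun y => phi (x, y) - avg phi x)%R (fun y => psi (x, y) - avg psi x)%R) => //.
    move=> y a yH aA; congr (_ - _)%R.
    have := phiA (x, y) (1, a); rewrite !inE xH yH aA group1 => /(_ isT isT) <-.
    by congr phi; rewrite -[RHS]/(x * 1, y * a) mulg1.
  move=> y a yH aA; congr (_ - _)%R.
  have := psiB (x, y) (1, a); rewrite !inE xH yH aA group1 => /(_ isT isT) <-.
  by congr psi; rewrite -[RHS]/(x * 1, y * a) mulg1.
have n0 : (0 <= n)%R by [].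
move: g2 g1; do 6?[move: (\sum_(x in H1) _)%R => ?].
by move=> g2 /(ler_wpM2l n0); nra.
Qed.

Lemma coset_family_prod (R : realType) m (gT1 gT2 : finGroupType) (eps : R)
  (K1 : {set 'I_m} -> {group gT1}) (K2 : {set 'I_m} -> {group gT2}) :
  coset_family K1 eps -> coset_family K2 eps ->
  coset_family (fun S => setX_group (K1 S) (K2 S)) eps.
Proof.
move=> fam1 fam2; split=> [S T||S i j l [x1 x2] [z1 z2] ij jl il||S i j ij SE] /=.
- apply/setP => -[x1 x2]; rewrite !inE /= (cfam_meet fam1) (cfam_meet fam2) !inE.
  by rewrite andbACA.
- apply/setP => -[x1 x2]; rewrite !inE /= (cfam_full fam1) (cfam_full fam2) !inE.
  by rewrite xpair_eqE.
- rewrite !inE /= => /andP[x1i x2i] /andP[z1l z2l] /andP[xz1 xz2].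
  have [y1 ? ?] := cfam_flag fam1 ij jl il x1i z1l xz1.
  have [y2 ? ?] := cfam_flag fam2 ij jl il x2i z2l xz2.
  by exists (y1, y2); rewrite !inE /=; apply/andP; split.
- move=> S Sm; set P := <<_>>.
  have PX l x1 x2 : l \in ~: S -> x1 \in K1 (l |: S) -> x2 \in K2 (l |: S) -> (x1, x2) \in P.
    move=> lS x1l x2l; apply: mem_gen; apply/bigcupP; exists l => //.
    by rewrite inE /= x1l x2l.
  have s1 : K1 S \subset @pairg1 gT1 gT2 @*^-1 P.
    apply: subset_trans (cfam_gen fam1 Sm) _; rewrite gen_subG.
    apply/bigcupsP => l lS; apply/subsetP => x xl.
    by rewrite !inE; apply: (PX l).
  have s2 : K2 S \subset @pair1g gT1 gT2 @*^-1 P.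
    apply: subset_trans (cfam_gen fam2 Sm) _; rewrite gen_subG.
    apply/bigcupsP => l lS; apply/subsetP => x xl.
    by rewrite !inE; apply: (PX l).
  apply/subsetP => -[x1 x2]; rewrite inE /= => /andP[x1S x2S].
  have -> : (x1, x2) = @pairg1 gT1 gT2 x1 * @pair1g gT1 gT2 x2.
    by rewrite -[RHS]/(x1 * 1, 1 * x2) mulg1 mul1g.
  have := subsetP s1 _ x1S; have := subsetP s2 _ x2S; rewrite !inE /= => p2 p1.
  exact: groupM.
- have sub1 l := cfam_sub fam1 (subsetUr [set l] S).
  have sub2 l := cfam_sub fam2 (subsetUr [set l] S).
  exact: coset_gap_prod (sub1 i) (sub1 j) (sub2 i) (sub2 j)
    (cfam_gap fam1 ij SE) (cfam_gap fam2 ij SE).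
Qed.

Lemma coset_family_perm (R : realType) m (gT : finGroupType) (eps : R)
  (K : {set 'I_m} -> {group gT}) (s : {perm 'I_m}) :
  coset_family K eps -> coset_family (fun S => K (s @: S)) eps.
Proof.
have sU l S : s @: (l |: S) = s l |: s @: S by rewrite imsetU imset_set1.
have sC S : s @: (~: S) = ~: (s @: S).
  apply/setP => x; rewrite inE -[x](permKV s) !mem_imset ?inE //; exact: perm_inj.
move=> fam; split=> [S T||S i j l x z ij jl il||S i j ij SE] /=.
- by rewrite imsetU (cfam_meet fam).
- have -> : s @: setT = setT by apply/setP => x; rewrite -[x](permKV s) imset_f ?inE.
  exact: (cfam_full fam).
- by rewrite !sU; apply: (cfam_flag fam); rewrite (inj_eq perm_inj).
- move=> S Sm; have := cfam_gen fam (S := s @: S).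
  rewrite card_imset; last exact: perm_inj.
  move=> /(_ Sm) /subset_trans; apply; rewrite gen_subG; apply/bigcupsP => l.
  rewrite -sC => /imsetP[l' l'S ->]; rewrite -sU.
  by apply/subsetP => x xl; apply/mem_gen/bigcupP; exists l'.
- rewrite !sU; apply: (cfam_gap fam); rewrite ?(inj_eq perm_inj) //.
  by rewrite SE sC imsetU !imset_set1.
Qed.

Lemma coset_family_trivial (R : realType) m (gT : finGroupType) (eps : R) :
  (0 <= eps)%R -> coset_family (fun _ : {set 'I_m} => 1%G : {group gT}) eps.
Proof.
move=> eps0; split=> [S T||S i j l x z _ _ _ x1 _ _||S i j _ _] /=.
- by rewrite setIid.
- by [].
- by exists 1; rewrite ?group1 // invg1 mul1g.
- by move=> S _; apply: sub1G.
- move=> phi psi _ _ ; rewrite !big_set1 => -> ->.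
  by rewrite !mulr0 expr0n /= addr0 mulr0.
Qed.

Lemma coset_family_prod_perm (R : realType) m (gT : finGroupType) (eps : R)
  (K : {set 'I_m} -> {group gT}) (ss : seq {perm 'I_m}) :
  (0 <= eps)%R -> coset_family K eps ->
  exists (gT' : finGroupType) (K' : {set 'I_m} -> {group gT'}),
    coset_family K' eps /\ forall S : {set 'I_m}, #|K' S| = (\prod_(s <- ss) #|K (s @: S)|)%N.
Proof.
move=> eps0 fam; elim: ss => [|s ss [gT' [K' [fam' cK']]]].
  exists gT, (fun=> 1%G); split; first exact: coset_family_trivial.
  by move=> S; rewrite big_nil cards1.
exists (gT * gT')%type, (fun S : {set 'I_m} => setX_group (K (s @: S)) (K' S)); split.
  by apply: coset_family_prod fam'; apply: coset_family_perm.
by move=> S; rewrite cardsX big_cons cK'.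
Qed.

(** A transposition exchanging a point of [S] outside [S'] with a point of [S'] outside [S] brings
    the two sets closer. *)
Lemma perm_invariant_card m (T : Type) (F : {set 'I_m} -> T) :
  (forall (s : {perm 'I_m}) (S : {set 'I_m}), F (s @: S) = F S) ->
  forall S S' : {set 'I_m}, #|S| = #|S'| -> F S = F S'.
Proof.
move=> FP S S'; have [k] := ubnP #|S :\: S'|; elim: k S => // k IH S Sk SS'.
have [D0|[a aD]] := set_0Vmem (S :\: S').
  by congr F; apply/eqP; rewrite eqEcard SS' leqnn -setD_eq0 D0 eqxx.
have /set0Pn[b bD] : S' :\: S != set0.
  rewrite -card_gt0 cardsD -SS' setIC -cardsD card_gt0; apply/set0Pn; by exists a.
rewrite -(FP (tperm a b) S); move: aD bD; rewrite !inE => /andP[aS' aS] /andP[bS bS'].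
have tE : tperm a b @: S = b |: S :\ a.
  apply/setP => x; rewrite -{1}[x](tpermK a b) mem_imset; last exact: perm_inj.
  rewrite !inE; case: tpermP => [->|->|/eqP xa /eqP xb].
  - by rewrite eqxx (negPf bS) /= orbF; apply/esym/eqP => ab; rewrite ab bS' in aS'.
  - by rewrite eqxx aS.
  - by rewrite (negPf xb) xa.
have bSa : b \notin S :\ a by rewrite !inE (negPf bS) andbF.
have cE : #|b |: S :\ a| = #|S| by rewrite cardsU1 bSa (cardsD1 a S) aS.
rewrite tE; apply: IH; last by rewrite cE.
rewrite ltnS in Sk; apply: leq_trans Sk; apply: proper_card; apply/properP; split.
  apply/subsetP => x; rewrite !inE => /andP[xS' /orP[/eqP xb|/andP[_ ->]]].
    by rewrite xb bS' in xS'.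
  by rewrite xS'.
exists a; rewrite !inE ?aS' ?aS // eqxx /= orbF.
by apply: contraNneq aS' => ->.
Qed.

Local Close Scope group_scope.

(** * The path algebra of the cyclic quiver *)

Section Arrows.
Variables (m' : nat).
Local Notation m := m'.+1.
Implicit Types (S T : {set 'I_m}) (i j l : 'I_m) (v w u k : nat).

Definition residue k : 'I_m := inord (k %% m).

Lemma val_residue k : residue k = (k %% m)%N :> nat.
Proof. by rewrite /residue inordK // ltn_pmod. Qed.

Lemma residue_id i : residue i = i.
Proof. by apply: val_inj; rewrite /= val_residue modn_small. Qed.

Lemma eq_residue v w : (residue v == residue w) = (v == w %[mod m]).
Proof. by rewrite -(inj_eq val_inj) /= !val_residue. Qed.

Lemma residueD v w : residue (residue v + w) = residue (v + w).
Proof. by apply/eqP; rewrite eq_residue val_residue modnDml. Qed.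

Lemma residue_period v : residue (v + m) = residue v.
Proof. by apply/eqP; rewrite eq_residue modnDr. Qed.

(* The path of length [d] starting at vertex [v] of the cyclic quiver uses the
   arrows [v], ..., [v + d - 1] modulo [m]. *)
Definition crosses S v d := has (fun e => residue (v + e) \in S) (iota 0 d).

Lemma crossesP S v d : reflect (exists2 e, (e < d)%N & residue (v + e) \in S) (crosses S v d).
Proof.
by apply: (iffP hasP) => [[e]|[e ed eS]]; [rewrite mem_iota|]; exists e; rewrite ?mem_iota.
Qed.

Lemma crossesD S v a b : crosses S v (a + b) = crosses S v a || crosses S (v + a) b.
Proof.
rewrite /crosses iotaD has_cat add0n; congr (_ || _).
rewrite -[a in iota a b]addn0 iotaDl has_map; apply: eq_has => e /=.
by rewrite addnA.
Qed.

Lemma crossesU S T v d : crosses (S :|: T) v d = crosses S v d || crosses T v d.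
Proof. by rewrite /crosses -has_predU; apply: eq_has => e; rewrite inE. Qed.

Lemma crosses_residue S v d : crosses S (residue v) d = crosses S v d.
Proof. by apply: eq_has => e; rewrite residueD. Qed.

Lemma crosses1 S v : crosses S v 1 = (residue v \in S).
Proof. by rewrite /crosses /= orbF addn0. Qed.

Lemma crosses_setT v d : crosses setT v d = (0 < d)%N.
Proof. by case: d => // d; rewrite /crosses /= inE. Qed.

(** A path of length [m] goes once around the cycle. Hence avoiding a nonempty [S] keeps lengths
    below [m], which is why the groups of nonempty [S] do not see the truncation. *)
Lemma crosses_long S v d : S != set0 -> (m <= d)%N -> crosses S v d.
Proof.
(* The witness is the distance from [v] forward to the next vertex of residue [s]. *)
case/set0Pn => s sS md; apply/crossesP; exists ((s + (m - v %% m)) %% m)%N.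
  by apply: leq_trans md; rewrite ltn_pmod.
have -> : residue (v + (s + (m - v %% m)) %% m) = s; last by [].
rewrite -[RHS]residue_id; apply/eqP; rewrite eq_residue modnDmr.
have := divn_eq v m; have := ltn_pmod v (ltn0Sn m').
set q := (v %/ m)%N; set r := (v %% m)%N => rm ->.
have -> : (q * m + r + (s + (m - r)) = q.+1 * m + s)%N by rewrite mulSn; lia.
by rewrite modnMDl.
Qed.

(* Position of vertex [v] after cutting the cycle open at arrow [i]. *)
Definition rpos i v := ((v + (m - i.+1)) %% m)%N.

Lemma eq_rpos i v w : (rpos i v == rpos i w) = (residue v == residue w).
Proof. by rewrite eq_residue /rpos eqn_modDr. Qed.

Lemma rpos_residue i v : rpos i (residue v) = rpos i v.
Proof. by apply/eqP; rewrite eq_rpos residue_id. Qed.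

Lemma rposS i v : residue v != i -> rpos i v.+1 = (rpos i v).+1.
Proof.
move=> vi; rewrite /rpos addSn modnS ifF //.
apply: contraNF vi => /dvdnP[q e].
rewrite -[X in _ == X]residue_id eq_residue -(eqn_modDr (m - i.+1).+1).
have -> : (i + (m - i.+1).+1 = m)%N by have := ltn_ord i; lia.
by rewrite addnS e modnMl modnn.
Qed.

Lemma rposD i v d : ~~ crosses [set i] v d -> rpos i (v + d) = (rpos i v + d)%N.
Proof.
elim: d => [|d IH]; first by rewrite !addn0.
rewrite -{1}[d.+1]addn1 crossesD negb_or => /andP[c1 c2].
by rewrite !addnS rposS ?IH //; move: c2; rewrite crosses1 inE.
Qed.

(** A path avoiding arrow [i] never wraps around the cut, so the arrows it uses fill an interval of
    positions. *)
Lemma crosses_rpos i j v d : ~~ crosses [set i] v d ->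
  crosses [set j] v d = (rpos i v <= rpos i j < rpos i (v + d))%N.
Proof.
move=> ci; rewrite rposD //; apply/crossesP/idP => [[e ed]|/andP[le lt]].
  rewrite inE -{1}[j]residue_id -(eq_rpos i) => /eqP <-.
  rewrite rposD ?leq_addr ?ltn_add2l //; apply: contra ci.
  by rewrite -(subnKC (ltnW ed)) crossesD => ->.
exists (rpos i j - rpos i v)%N; first by lia.
have ed : (rpos i j - rpos i v <= d)%N by lia.
rewrite inE -[X in _ == X]residue_id -(eq_rpos i) rposD ?subnKC //.
by apply: contra ci; rewrite -(subnKC ed) crossesD => ->.
Qed.

End Arrows.

(** * The truncated path algebra as periodic matrices *)

Section PeriodicMatrices.
Variables (F : finFieldType) (n m' : nat).
Local Notation m := m'.+1.
Local Notation mat := 'M[F]_n.+1.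
Implicit Types (S T : {set 'I_m}) (N A B : mat) (r l : 'I_m).

(** For strictly upper triangular matrices, commuting with this shift is equivalent to periodicity,
    and in this form periodicity is visibly stable under products. *)
Definition shiftmx : mat := \matrix_(i, j) (j == (i + m)%N :> nat)%:R.

Definition periodic N := forall i j i' j' : 'I_n.+1,
  i' = (i + m)%N :> nat -> j' = (j + m)%N :> nat -> N i' j' = N i j.

(* The span of the paths of positive length avoiding the arrows in [S]. *)
Definition path_alg S N := (N *m shiftmx == shiftmx *m N) &&
  [forall i : 'I_n.+1, forall j : 'I_n.+1,
     ((j <= i) || crosses S i (j - i))%N ==> (N i j == 0)].

Lemma mul_shiftmx N (i j j' : 'I_n.+1) : j' = (j + m)%N :> nat ->
  (N *m shiftmx) i j' = N i j.
Proof.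
move=> e; rewrite mxE (bigD1 j) //= mxE e eqxx mulr1 big1 ?addr0 // => k kj.
by rewrite mxE e eqn_add2r eq_sym -[(_ == _)%N]/(k == j) (negPf kj) mulr0.
Qed.

Lemma shiftmx_mul N (i i' j : 'I_n.+1) : i' = (i + m)%N :> nat ->
  (shiftmx *m N) i j = N i' j.
Proof.
move=> e; rewrite mxE (bigD1 i') //= mxE e eqxx mul1r big1 ?addr0 // => k kj.
by rewrite mxE -e -[(_ == _)%N]/(k == i') (negPf kj) mul0r.
Qed.

Lemma path_algP S N : reflect (periodic N /\
    forall i j : 'I_n.+1, ((j <= i) || crosses S i (j - i))%N -> N i j = 0)
  (path_alg S N).
Proof.
apply: (iffP andP) => [[/eqP cN /forallP zN]|[pN zN]]; split.
- by move=> i j i' j' ii' jj'; rewrite -(shiftmx_mul _ _ ii') -cN (mul_shiftmx _ _ jj').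
- by move=> i j ij; have /forallP/(_ j)/implyP/(_ ij)/eqP := zN i.
- apply/eqP/matrixP => i j.
  have [jm|mj] := ltnP j m.
    rewrite mxE big1 => [|k _]; last by rewrite mxE (_ : _ == _ = false) ?mulr0 //; lia.
    have [mi|mi] := ltnP (i + m)%N n.+1.
      by rewrite (@shiftmx_mul _ _ (Ordinal mi)) // zN //=; lia.
    rewrite mxE big1 // => k _; rewrite mxE (_ : _ == _ = false) ?mul0r //.
    by have := ltn_ord k; lia.
  have jj : (j - m < n.+1)%N by have := ltn_ord j; lia.
  rewrite (@mul_shiftmx _ _ (Ordinal jj)) /=; last by lia.
  have [mi|mi] := ltnP (i + m)%N n.+1.
    rewrite (@shiftmx_mul _ _ (Ordinal mi)) //; apply/esym/pN => //=; lia.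
  rewrite zN; last by have := ltn_ord j; rewrite /=; lia.
  rewrite mxE big1 // => k _; rewrite mxE (_ : _ == _ = false) ?mul0r //.
  by have := ltn_ord k; lia.
- by apply/forallP => i; apply/forallP => j; apply/implyP => /zN ->.
Qed.

Lemma path_alg_comm S N : path_alg S N -> N *m shiftmx = shiftmx *m N.
Proof. by case/andP => /eqP. Qed.

Lemma path_alg_eq0 S N (i j : 'I_n.+1) : path_alg S N ->
  ((j <= i) || crosses S i (j - i))%N -> N i j = 0.
Proof. by case/path_algP => _; apply. Qed.

Lemma path_alg0 S : path_alg S 0.
Proof. by apply/path_algP; split=> [i j i' j' _ _|i j _]; rewrite !mxE. Qed.

Lemma path_algD S A B : path_alg S A -> path_alg S B -> path_alg S (A + B).
Proof.
move=> /path_algP[pA zA] /path_algP[pB zB]; apply/path_algP; split.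
  by move=> i j i' j' ii jj; rewrite !mxE (pA i j) // (pB i j).
by move=> i j ij; rewrite mxE zA // zB // addr0.
Qed.

Lemma path_algZ S (c : F) A : path_alg S A -> path_alg S (c *: A).
Proof.
move=> /path_algP[pA zA]; apply/path_algP; split.
  by move=> i j i' j' ii jj; rewrite !mxE (pA i j).
by move=> i j ij; rewrite mxE zA // mulr0.
Qed.

Lemma path_algM S A B : path_alg S A -> path_alg S B -> path_alg S (A *m B).
Proof.
move=> PA PB; apply/andP; split.
  by rewrite -mulmxA (path_alg_comm PB) !mulmxA (path_alg_comm PA).
apply/forallP => i; apply/forallP => j; apply/implyP => ij.
rewrite mxE big1 // => k _.
have [ik|ki] := ltnP i k; last by rewrite (path_alg_eq0 PA) ?ki // mul0r.
have [kj|jk] := ltnP k j; last by rewrite (path_alg_eq0 PB) ?jk // mulr0.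
have : crosses S i (k - i) || crosses S k (j - k).
  rewrite leqNgt (ltn_trans ik kj) /= in ij.
  have e : (j - i = (k - i) + (j - k))%N by lia.
  by rewrite e crossesD subnKC // ltnW in ij.
case/orP => c; first by rewrite (path_alg_eq0 PA) ?c ?orbT // mul0r.
by rewrite (path_alg_eq0 PB) ?c ?orbT // mulr0.
Qed.

Lemma path_algU S T A : path_alg (S :|: T) A = path_alg S A && path_alg T A.
Proof.
apply/path_algP/andP => [[pA zA]|[/path_algP[pA zA] /path_algP[_ zB]]].
  by split; apply/path_algP; split=> // i j /orP[ij|c]; apply: zA; rewrite ?ij // crossesU c !orbT.
split=> // i j; rewrite crossesU => /orP[ij|/orP[c|c]]; first by rewrite zA ?ij.
- by rewrite zA // c orbT.
- by rewrite zB // c orbT.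
Qed.

Lemma path_alg_setT A : path_alg setT A -> A = 0.
Proof.
move=> /path_algP[_ zA]; apply/matrixP => i j; rewrite mxE; apply: zA.
by rewrite crosses_setT subn_gt0; lia.
Qed.

Lemma path_alg_unit S A : path_alg S A -> 1%:M + A \in unitmx.
Proof.
move=> PA; rewrite unitmxE -det_tr det_trig; last first.
  apply/is_trig_mxP => i j ij; rewrite !mxE (path_alg_eq0 PA) ?(ltnW ij) //.
  by rewrite -(inj_eq val_inj) /= gtn_eqF // addr0.
by rewrite big1 ?unitr1 // => i _; rewrite !mxE (path_alg_eq0 PA) ?leqnn // eqxx addr0.
Qed.

(** The basis element given by the path of length [d] from residue [r]: the sum of all its lifts to
    the vertices [0, ..., n]. *)
Definition path_mx r d : mat := \matrix_(i, j) ((residue m' i == r) && (j == (i + d)%N :> nat))%:R.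

Lemma path_mxM r d r' d' : path_mx r d *m path_mx r' d' =
  if residue m' (r + d) == r' then path_mx r (d + d') else 0.
Proof.
apply/matrixP => i j; rewrite mxE.
have [idn|idn] := ltnP (i + d)%N n.+1; last first.
  rewrite big1 => [|k _]; last first.
    rewrite [path_mx _ _ _ _]mxE (_ : (k == _ :> nat) = false) ?andbF ?mul0r //.
    by have := ltn_ord k; lia.
  case: ifP => _; rewrite !mxE // (_ : (j == _ :> nat) = false) ?andbF //.
  by have := ltn_ord j; lia.
rewrite (bigD1 (Ordinal idn)) //= big1 => [|k kn]; last first.
  by rewrite mxE (_ : (k == _ :> nat) = false) ?andbF ?mul0r //; apply: contraNF kn => /eqP e; apply/eqP/val_inj.
rewrite !mxE /= eqxx andbT addr0.
case: (eqVneq (residue m' i) r) => [<-|ir]; last by rewrite mul0r; case: ifP; rewrite !mxE ?(negPf ir).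
rewrite mul1r residueD; case: ifP => c; rewrite !mxE ?addnA ?eqxx //.
Qed.

Lemma path_mx_alg S r d : (0 < d)%N -> ~~ crosses S r d -> path_alg S (path_mx r d).
Proof.
move=> d0 cr; apply/path_algP; split.
  move=> i j i' j' ii jj; rewrite !mxE ii jj residue_period; congr (_ && _)%:R.
  by rewrite addnAC eqn_add2r.
move=> i j ij; rewrite mxE; case: eqP => //= ir; case: eqP => // jd.
by case/negP: cr; move: ij; rewrite jd addKn -ir crosses_residue leqNgt -[X in (X < _)%N]addn0 ltn_add2l d0.
Qed.

(* Meaningful only for [r + d <= n]: beyond that, [inord] returns a junk index. *)
Definition coef A (r d : nat) : F := A (inord r) (inord (r + d)).

Lemma coefE A (i j : 'I_n.+1) : periodic A -> (i <= j)%N ->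
  A i j = coef A (i %% m) (j - i).
Proof.
move=> pA; have [k] := ubnP i; elim: k i j => // k IH i j ik ij.
have [im|mi] := ltnP i m.
  by rewrite /coef modn_small // subnKC // !inord_val.
have ii : (i - m < n.+1)%N by have := ltn_ord i; lia.
have jj : (j - m < n.+1)%N by have := ltn_ord j; lia.
rewrite (pA (Ordinal ii) (Ordinal jj)) /=; [| lia | lia].
rewrite IH /=; [| lia | lia].
congr coef; last by lia.
by rewrite -[in RHS](subnK mi) modnDr.
Qed.

End PeriodicMatrices.

(** * The path groups and their flag property *)

Section PathGroups.
Variables (F : finFieldType) (n m' : nat).
Local Notation m := m'.+1.
Local Notation mat := 'M[F]_n.+1.
Local Notation gT := {unit mat}.
Implicit Types (S T : {set 'I_m}) (N A B : mat) (r l i j : 'I_m) (g x y z : gT).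

Definition path_group_set S : {set gT} := [set g | path_alg S (val g - 1)].

Lemma val_mulg_sub1 x y :
  val (x * y)%g - 1 = (val x - 1) *m (val y - 1) + ((val x - 1) + (val y - 1)).
Proof.
rewrite mulmxE mulrBl mul1r mulrBr mulr1.
by rewrite [X in _ = _ + X]addrC addrA subrK addrA subrK.
Qed.

Lemma path_groupP S : group_set (path_group_set S).
Proof.
apply/group_setP; split=> [|x y]; first by rewrite inE /= subrr path_alg0.
rewrite !inE val_mulg_sub1 => Px Py.
by apply: path_algD; [exact: path_algM | exact: path_algD].
Qed.

Definition path_group S : {group gT} := Group (path_groupP S).

Lemma mem_path_group S g : (g \in path_group S) = path_alg S (val g - 1).
Proof. by rewrite inE. Qed.

Lemma path_unit S A : path_alg S A -> exists2 g, g \in path_group S & val g = 1 + A.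
Proof.
move=> PA; have U : (1 + A) \is a GRing.unit by apply: path_alg_unit PA.
by exists (FinRing.unit mat U) => //; rewrite mem_path_group /= addrC addKr.
Qed.

Lemma path_groupU S T : path_group (S :|: T) = path_group S :&: path_group T :> {set gT}.
Proof. by apply/setP => g; rewrite in_setI !mem_path_group path_algU. Qed.

Lemma mem_path_groupU1 l S g :
  (g \in path_group (l |: S)) = (g \in path_group [set l]) && (g \in path_group S).
Proof. by rewrite path_groupU in_setI. Qed.

Lemma path_groupS S T : S \subset T -> path_group T \subset path_group S.
Proof. by move=> /setUidPr <-; rewrite path_groupU subsetIl. Qed.

Lemma path_group_setT : path_group setT = 1%g :> {set gT}.
Proof.
apply/setP => g; rewrite mem_path_group inE; apply/idP/eqP => [/path_alg_setT/eqP|->].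
  by rewrite subr_eq0 => /eqP e; apply: val_inj.
by rewrite /= subrr path_alg0.
Qed.

(** Taking the generated subgroup instead of [path_group set0] makes generation at the empty face
    hold by construction; intersecting with it leaves the groups of nonempty [S] unchanged. *)
Definition path_full : {group gT} := <<\bigcup_(l : 'I_m) path_group [set l]>>%G.

Definition path_family S : {group gT} := (path_full :&: path_group S)%G.

Lemma path_familyE S : path_family S = path_full :&: path_group S :> {set gT}.
Proof. by []. Qed.

Lemma path_family_neq0 S : S != set0 -> path_family S = path_group S :> {set gT}.
Proof.
case/set0Pn => s sS; rewrite path_familyE; apply/setIidPr.
apply: subset_trans (path_groupS (T := S) (S := [set s]) _) _; first by rewrite sub1set.
by apply: sub_gen; apply: (bigcup_sup s).
Qed.

Lemma path_familyU1 l S : path_family (l |: S) = path_group (l |: S) :> {set gT}.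
Proof. by apply: path_family_neq0; apply/set0Pn; exists l; rewrite setU11. Qed.

Lemma path_family_meet S T : path_family (S :|: T) = path_family S :&: path_family T :> {set gT}.
Proof. by rewrite !path_familyE path_groupU setIACA setIid. Qed.

Lemma path_family_setT : path_family setT = 1%g :> {set gT}.
Proof. by rewrite path_familyE path_group_setT; apply/setIidPr; apply: sub1G. Qed.

Definition rows_mx (P : pred nat) A : mat :=
  \matrix_(u, v) (if P (residue m' u) then A u v else 0).

Lemma rows_mx_alg S P A : path_alg S A -> path_alg S (rows_mx P A).
Proof.
move=> /path_algP[pA zA]; apply/path_algP; split=> [u v u' v' uu vv|u v uv].
  by rewrite !mxE uu residue_period (pA u v).
by rewrite mxE zA // if_same.
Qed.

(** Write [A], [C] for [x - 1], [z - 1]. In positions cut at [i], a path from [u] to [v] passes [j]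
    and [l], so [A * C + A + C] and [C] vanish at [(u, v)]. A term of [A * C] through [w] vanishes
    too: if [w] is not beyond [l], its second factor passes [l]; otherwise its first factor is
    covered by induction on [v]. *)
Lemma path_flag_crossing S i j l x z : (rpos i j < rpos i l)%N ->
  x \in path_group (i |: S) -> z \in path_group (l |: S) -> (x * z)%g \in path_group (j |: S) ->
  forall u v : 'I_n.+1, (rpos i u <= rpos i j)%N -> (rpos i l < rpos i v)%N -> (val x - 1) u v = 0.
Proof.
rewrite !mem_path_group val_mulg_sub1 => jl.
move: (val x - 1) (val z - 1) => A C PA PC PAC u v uj.
have z0 B k S' (a b : 'I_n.+1) : path_alg (k |: S') B -> crosses [set k] a (b - a) -> B a b = 0.
  by move=> PB c; rewrite (path_alg_eq0 PB) // crossesU c orbT.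
have [k] := ubnP v; elim: k v => // k IH v vk lv.
have [uv|vu] := ltnP u v; last by rewrite (path_alg_eq0 PA) ?vu.
case: (boolP (crosses [set i] u (v - u))) => [ci|nci]; first exact: z0 PA ci.
have cr j' : (rpos i u <= rpos i j' < rpos i v)%N -> crosses [set j'] u (v - u).
  by rewrite (crosses_rpos _ nci) subnKC // ltnW.
have : (A *m C + (A + C)) u v = 0 by apply: (z0 _ _ _ _ _ PAC); apply: cr; lia.
rewrite !mxE (z0 _ _ _ _ _ PC); last by apply: cr; lia.
rewrite addr0 big1 ?add0r // => w _.
have [uw|wu] := ltnP u w; last by rewrite (path_alg_eq0 PA) ?wu ?mul0r.
have [wv|vw] := ltnP w v; last by rewrite (path_alg_eq0 PC) ?vw ?mulr0.
have e : (v - u = (w - u) + (v - w))%N by lia.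
move: nci; rewrite e crossesD subnKC ?(ltnW uw) // negb_or => /andP[_ nwv].
have [wl|lw] := leqP (rpos i w) (rpos i l).
  rewrite (z0 _ _ _ _ _ PC) ?mulr0 // (crosses_rpos _ nwv) subnKC ?wl //; exact: ltnW.
by rewrite IH ?mul0r //; lia.
Qed.

(** Cut [x - 1] into the rows [X] beyond arrow [j] and the other rows [Y]. Paths avoiding [i] never
    return before [j], so [X * Y = 0] and [x = (1 + X) * (1 + Y)]. Rows beyond [j] avoid [j], and
    [Y] avoids [l] by [path_flag_crossing]; take [y = 1 + X]. *)
Lemma path_flag_oriented S i j l x z : (rpos i j < rpos i l)%N ->
  x \in path_group (i |: S) -> z \in path_group (l |: S) -> (x * z)%g \in path_group (j |: S) ->
  exists2 y, y \in path_group (i |: (j |: S)) & (y^-1 * x)%g \in path_group (l |: (i |: S)).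
Proof.
move=> jl Px Pz Pxz; have zero := path_flag_crossing jl Px Pz Pxz.
rewrite mem_path_group in Px.
have [A xE] : exists A, A = val x - 1 by eexists.
rewrite -xE in Px zero.
pose P : pred nat := fun u => (rpos i j < rpos i u)%N.
have Prow u : P (residue m' u) = P u by rewrite /P rpos_residue.
have mono (u v : 'I_n.+1) : P u -> A u v != 0 -> P v.
  move=> Pu Auv; have [uv|vu] := ltnP u v; last first.
    by rewrite (path_alg_eq0 Px) ?vu ?eqxx in Auv.
  case: (boolP (crosses [set i] u (v - u))) => [ci|nci].
    by rewrite (path_alg_eq0 Px) ?eqxx // crossesU ci orbT in Auv.
  move: Pu; rewrite /P => /leq_trans; apply.
  by rewrite -(subnKC (ltnW uv)) (rposD nci) leq_addr.
pose X := rows_mx P A; pose Y := rows_mx (predC P) A.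
have AE : A = X + Y.
  by apply/matrixP => u v; rewrite !mxE /=; case: (P _); rewrite ?addr0 ?add0r.
have XY : X *m Y = 0.
  apply/matrixP => u v; rewrite !mxE big1 // => w _; rewrite !mxE /= !Prow.
  case: (boolP (P u)) => Pu; last by rewrite mul0r.
  case: (boolP (P w)) => Pw; first by rewrite mulr0.
  by case: (eqVneq (A u w) 0) => [->|/(mono _ _ Pu)]; rewrite ?mul0r // (negPf Pw).
have PX : path_alg (i |: (j |: S)) X.
  rewrite setUCA path_algU (rows_mx_alg _ Px) andbT.
  have /path_algP[pX _] := rows_mx_alg P Px; apply/path_algP; split=> // u v /orP[vu|c].
    by rewrite (path_alg_eq0 (rows_mx_alg P Px)) ?vu.
  case: (boolP (crosses [set i] u (v - u))) => [ci|nci].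
    by rewrite (path_alg_eq0 (rows_mx_alg P Px)) // crossesU ci orbT.
  rewrite mxE Prow; case: ifP => //; rewrite /P ltnNge.
  by move: c; rewrite (crosses_rpos _ nci) => /andP[-> _].
have PY : path_alg (l |: (i |: S)) Y.
  rewrite path_algU (rows_mx_alg _ Px) andbT.
  have /path_algP[pY _] := rows_mx_alg (predC P) Px; apply/path_algP; split=> // u v /orP[vu|c].
    by rewrite (path_alg_eq0 (rows_mx_alg _ Px)) ?vu.
  have [uv|vu] := ltnP u v; last by rewrite (path_alg_eq0 (rows_mx_alg _ Px)) ?vu.
  case: (boolP (crosses [set i] u (v - u))) => [ci|nci].
    by rewrite (path_alg_eq0 (rows_mx_alg _ Px)) // crossesU ci orbT.
  rewrite mxE /= Prow; case: ifP => //; rewrite /P -leqNgt => uj.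
  move: c; rewrite (crosses_rpos _ nci) subnKC ?(ltnW uv) // => /andP[_ lv].
  exact: zero.
have [y yP yE] := path_unit PX; have [w wP wE] := path_unit PY.
exists y => //; have -> : x = (y * w)%g.
  apply: val_inj; rewrite FinRing.val_unitM yE wE mulrDl mul1r mulrDr mulr1.
  by rewrite -mulmxE XY addr0 -addrA [Y + X]addrC -AE xE addrC subrK.
by rewrite mulKg.
Qed.

Lemma rpos_ord i j : rpos i j = if (i < j)%N then (j - i.+1)%N else (j + (m - i.+1))%N.
Proof.
rewrite /rpos; have im := ltn_ord i; have jm := ltn_ord j; case: (ltnP i j) => ij.
  have -> : (j + (m - i.+1) = (j - i.+1) + m)%N by lia.
  by rewrite modnDr modn_small //; lia.
by rewrite modn_small //; lia.
Qed.

(** If [i], [j], [l] occur in the other cyclic order, the oriented case applies with [i] and [j]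
    exchanged, to [x * z] and the inverse of [z]: the triangle of cosets is the same and so is its
    common element. *)
Lemma path_flag S i j l x z : i != j -> j != l -> i != l ->
  x \in path_group (i |: S) -> z \in path_group (l |: S) -> (x * z)%g \in path_group (j |: S) ->
  exists2 y, y \in path_group (i |: (j |: S)) & (y^-1 * x)%g \in path_group (l |: (i |: S)).
Proof.
move=> ij jl il Px Pz Pxz.
have [lt|ge] := ltnP (rpos i j) (rpos i l); first exact: path_flag_oriented lt Px Pz Pxz.
have lt : (rpos j i < rpos j l)%N.
  move: ij jl il ge; rewrite -!(inj_eq val_inj) /= !rpos_ord.
  have im := ltn_ord i; have jm := ltn_ord j; have lm := ltn_ord l.
  by case: (ltnP i j); case: (ltnP i l); case: (ltnP j i); case: (ltnP j l); lia.
have Pzi : (z^-1)%g \in path_group (l |: S) by rewrite groupV.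
have [|y yP yQ] := path_flag_oriented lt Pxz Pzi; first by rewrite mulgK.
exists y; first by rewrite setUCA.
have yz : (y^-1 * x)%g = (y^-1 * (x * z) * z^-1)%g by rewrite !mulgA mulgK.
have := Px; rewrite (mem_path_groupU1 i S) => /andP[xi xS].
have := Pzi; rewrite (mem_path_groupU1 l S) => /andP[zl zS].
have := yQ; rewrite (mem_path_groupU1 l) => /andP[yl _].
have := yP; rewrite (mem_path_groupU1 j) (mem_path_groupU1 i S) => /and3P[yj yi yS].
by rewrite (mem_path_groupU1 l) (mem_path_groupU1 i S) yz (groupM yl zl) -yz !groupM ?groupV.
Qed.

End PathGroups.

(** * Generation by elementary matrices *)

Section PathGenerators.
Variables (F : finFieldType) (n m' : nat).
Local Notation m := m'.+1.
Local Notation mat := 'M[F]_n.+1.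
Local Notation gT := {unit mat}.
(** A path with start [r < m] and length [d < m] ends at a vertex at most [2m - 2], so [coef] reads
    a genuine matrix entry. *)
Hypothesis n_large : (m.*2 <= n.+1)%N.
Implicit Types (S T : {set 'I_m}) (N A B : mat) (r l i j : 'I_m) (g x y z : gT).

Local Notation E := (@path_mx F n m').
Local Notation U := (@path_group F n m').

Lemma coef_path_mx r d (r' : 'I_m) d' : (d' < m)%N ->
  coef (E r d) r' d' = ((r' == r) && (d' == d))%:R.
Proof.
move=> dm; have rm := ltn_ord r'; rewrite /coef mxE !inordK; [|lia..].
rewrite residue_id; case: eqP => //= _.
by rewrite eqn_add2l.
Qed.

Lemma coefD A B r d : coef (A + B) r d = coef A r d + coef B r d.
Proof. by rewrite /coef mxE. Qed.

Lemma coefZ c A r d : coef (c *: A) r d = c * coef A r d.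
Proof. by rewrite /coef mxE. Qed.

Lemma periodic_entry A r d (u v : 'I_n.+1) : periodic m' A ->
  residue m' u = r -> v = (u + d)%N :> nat -> A u v = coef A r d.
Proof.
move=> pA ur vd; rewrite (coefE pA) vd ?leq_addr // addKn.
by rewrite -val_residue ur.
Qed.

Lemma path_mx_long (r : 'I_m) d S A : S != set0 -> path_alg S A -> (0 < d < m)%N ->
  coef A r d != 0 -> ~~ crosses S r d.
Proof.
move=> S0 PA /andP[d0 dm]; have rm := ltn_ord r; apply: contra => c.
by rewrite /coef (path_alg_eq0 PA) // !inordK ?addKn ?c ?orbT //; lia.
Qed.

Lemma path_alg_eq A B S : S != set0 -> path_alg S A -> path_alg S B ->
  (forall r d, (0 < d < m)%N -> ~~ crosses S r d -> coef A r d = coef B r d) -> A = B.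
Proof.
move=> S0 PA PB AB; apply/matrixP => u v.
have [uv|vu] := ltnP u v; last by rewrite (path_alg_eq0 PA) ?(path_alg_eq0 PB) ?vu.
case: (boolP (crosses S u (v - u))) => [c|nc].
  by rewrite (path_alg_eq0 PA) ?(path_alg_eq0 PB) ?c ?orbT.
have dm : (v - u < m)%N by rewrite ltnNge; apply: contra nc; apply: crosses_long.
have vE : v = (u + (v - u))%N :> nat by lia.
have [pA _] := path_algP _ _ PA; have [pB _] := path_algP _ _ PB.
rewrite (periodic_entry pA (erefl _) vE) (periodic_entry pB (erefl _) vE).
by apply: AB; [lia | rewrite crosses_residue].
Qed.

Section Generation.
Variable S : {set 'I_m}.
Hypotheses (S0 : S != set0) (Sm : (#|S| + 2 <= m)%N).

Let P : {group gT} := <<\bigcup_(l in ~: S) U (l |: S)>>%G.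

Lemma ex_other_arrow r : exists2 l, l \notin S & l != r.
Proof.
have /card_gt1P[a [b [aS bS ab]]] : (1 < #|~: S|)%N.
  by rewrite (cardsCs (~: S)) setCK card_ord; lia.
rewrite !inE in aS bS.
case: (eqVneq a r) => [ar|ar]; last by exists a.
by exists b => //; rewrite -ar eq_sym.
Qed.

Lemma generator_mem l g : l \notin S -> g \in U (l |: S) -> g \in P.
Proof. by move=> lS gl; apply/mem_gen/bigcupP; exists l; rewrite ?in_setC. Qed.

(** A path of length one avoids some arrow outside [S] other than its own. A longer path is the
    first arrow [r] followed by a path avoiding [r], since [d < m]; its elementary matrix is the
    commutator of the two corresponding elements, each lying in a generating subgroup. *)
Lemma elementary_mem r d c g : (0 < d < m)%N -> ~~ crosses S r d ->
  val g = 1 + c *: E r d -> g \in P.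
Proof.
move=> /andP[d0 dm] nc gE.
have alg (r' : 'I_m) d' c' T : (0 < d')%N -> ~~ crosses T r' d' -> path_alg T (c' *: E r' d').
  by move=> ? ?; rewrite path_algZ // path_mx_alg.
have arrow r' c' x : ~~ crosses S r' 1 -> val x = 1 + c' *: E r' 1 -> x \in P.
  move=> nc' xE; have [l lS lr] := ex_other_arrow r'.
  apply: (generator_mem lS); rewrite mem_path_group xE addrC addKr.
  apply: alg => //; rewrite crossesU negb_or nc' andbT crosses1 residue_id inE.
  by rewrite eq_sym.
have [d1|d1] := eqVneq d 1%N; first by rewrite d1 in gE nc; apply: arrow nc gE.
have dE : d = (1 + d.-1)%N by lia.
move: (nc); rewrite {1}dE crossesD negb_or => /andP[nc1 nc2].
pose r' := residue m' (r + 1).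
have nc' : ~~ crosses (r |: S) r' d.-1.
  rewrite crossesU negb_or !crosses_residue nc2 andbT.
  apply/crossesP => -[e ed]; rewrite inE -[X in _ == X]residue_id eq_residue.
  rewrite -addnA -[X in _ == X %[mod _]]addn0 eqn_modDl mod0n modn_small; lia.
have rS : r \notin S by move: nc1; rewrite crosses1 residue_id.
have [x xP xE] : exists2 x, x \in P & val x = 1 + 1 *: E r 1.
  have [//|x _ xE] := @path_unit F n m' S (1 *: E r 1); first exact: alg.
  by exists x => //; apply: arrow xE.
have [w wP wE] : exists2 w, w \in P & val w = 1 + c *: E r' d.-1.
  have [|w wU wE] := @path_unit F n m' (r |: S) (c *: E r' d.-1); first by apply: alg => //; lia.
  by exists w => //; apply: generator_mem wU.
suff -> : g = (x * w * x^-1 * w^-1)%g by rewrite !groupM ?groupV.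
apply: (mulIg w); rewrite mulgKV; apply: (mulIg x); rewrite mulgKV.
apply: val_inj; rewrite !FinRing.val_unitM gE xE wE !scale1r.
have mulE (a b : 'I_m) (p q : nat) : E a p * E b q = if residue m' (a + p) == b then E a (p + q) else 0.
  exact: path_mxM.
have XW : E r 1 * E r' d.-1 = E r d by rewrite mulE eqxx dE.
have ne (p q : 'I_m) k : (0 < k < m)%N -> (residue m' (p + k) == p) = false.
  move=> km; rewrite -[X in _ == X]residue_id eq_residue -[X in _ == X %[mod _]]addn0 eqn_modDl mod0n modn_small; lia.
have WX : E r' d.-1 * E r 1 = 0.
  by rewrite mulE residueD -addnA -dE ne // d0.
have DX : E r d * E r 1 = 0 by rewrite mulE ne // d0.
have DW : E r d * E r' d.-1 = 0.
  rewrite mulE; suff -> : (residue m' (r + d) == r') = false by [].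
  rewrite eq_residue eqn_modDl (modn_small dm) modn_small; lia.
rewrite !(mulrDl, mulrDr, mul1r, mulr1) -!scalerAl -!scalerAr XW WX DX DW.
rewrite !scaler0 !mul0r ?scaler0 !addr0 -!addrA; congr (_ + _).
by rewrite !addrA addrAC.
Qed.

Definition coef_supp A := [set rd : 'I_m * 'I_m | (0 < rd.2)%N && (coef A rd.1 rd.2 != 0)].

Lemma mem_coef_supp A (r d : 'I_m) :
  ((r, d) \in coef_supp A) = (0 < d)%N && (coef A r d != 0).
Proof. by rewrite inE. Qed.

(** Cut the cycle at some [s] in [S] and split off a term [c *: E r d] whose start comes earliest.
    No remaining path ends at [r], as it would start earlier still; so [A' * E r d = 0] and
    [1 + A = (1 + A') * (1 + c *: E r d)]. *)
Lemma path_alg_generated A : path_alg S A -> exists2 g, g \in P & val g = 1 + A.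
Proof.
have [k] := ubnP #|coef_supp A|; elim: k A => // k IH A Ak PA.
have [A0|[rd0 rd0A]] := set_0Vmem (coef_supp A).
  exists 1%g => //=; rewrite (path_alg_eq S0 PA (path_alg0 _ _ _)) ?addr0 // => r d dm _.
  have dm' : (d < m)%N by case/andP: dm.
  apply/eqP; rewrite [X in _ == X]mxE; apply: contraT => nz.
  have : (r, Ordinal dm') \in coef_supp A by rewrite mem_coef_supp nz andbT; case/andP: dm.
  by rewrite A0 in_set0.
have /set0Pn[s sS] := S0.
case: (arg_minnP (fun rd : 'I_m * 'I_m => rpos s rd.1) rd0A) => -[r d] rdA rmin.
have := rdA : (r, d) \in coef_supp A; rewrite mem_coef_supp => /andP[d0 cA]; set c := coef A r d in cA.
have dm : (0 < d < m)%N by rewrite d0 ltn_ord.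
have nc := path_mx_long S0 PA dm cA.
pose A' := A + (- c) *: E r d.
have PA' : path_alg S A' by rewrite path_algD ?path_algZ ?path_mx_alg.
have coefA' (r1 d1 : 'I_m) : coef A' r1 d1 = coef A r1 d1 - c * ((r1, d1) == (r, d))%:R.
  by rewrite coefD coefZ coef_path_mx // mulNr.
have sub : coef_supp A' \subset coef_supp A :\ (r, d).
  apply/subsetP => -[r1 d1]; rewrite in_setD1 !mem_coef_supp coefA' => /andP[d10].
  rewrite d10; case: (eqVneq (r1, d1) (r, d)) => [[-> ->]|_]; first by rewrite mulr1 subrr eqxx.
  by rewrite mulr0 subr0.
have AE : A = A' + c *: E r d by rewrite /A' scaleNr subrK.
have A'E : A' * E r d = 0.
  rewrite -mulmxE; apply/matrixP => u v; rewrite mxE [RHS]mxE big1 // => w _.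
  apply/eqP; rewrite mulf_eq0; apply: contraT; rewrite negb_or => /andP[uw].
  rewrite mxE; case: (eqVneq (residue m' w) r) => [wr _|_]; last by rewrite eqxx.
  have [uw1|wu] := ltnP u w; last by rewrite (path_alg_eq0 PA') ?wu ?eqxx in uw.
  have ncw : ~~ crosses S u (w - u).
    by apply: contra uw => cw; rewrite (path_alg_eq0 PA') ?cw ?orbT.
  have ncs : ~~ crosses [set s] u (w - u).
    by apply: contra ncw => /crossesP[e eu /set1P es]; apply/crossesP; exists e; rewrite ?es.
  have dw : (w - u < m)%N by rewrite ltnNge; apply: contra ncw; apply: crosses_long.
  have wE : w = (u + (w - u))%N :> nat by rewrite subnKC // ltnW.
  have [pA' _] := path_algP _ _ PA'.
  have : (residue m' u, Ordinal dw) \in coef_supp A'.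
    by rewrite mem_coef_supp -(periodic_entry pA' (erefl _) wE) uw andbT subn_gt0.
  move=> /(subsetP sub); rewrite in_setD1 => /andP[_ /rmin] /=.
  by rewrite rpos_residue -wr rpos_residue {1}wE (rposD ncs) leqNgt -[X in (X < _)%N]addn0 ltn_add2l subn_gt0 uw1.
have [|g' g'P g'E] := IH A' _ PA'.
  rewrite ltnS in Ak; apply: leq_trans Ak; rewrite (cardsD1 (r, d) (coef_supp A)).
  rewrite (rdA : ((r, d) \in coef_supp A) = true).
  by rewrite ltnS subset_leq_card.
have [e eP eE] : exists2 e, e \in P & val e = 1 + c *: E r d.
  have [|e _ eE] := @path_unit F n m' S (c *: E r d); first by rewrite path_algZ ?path_mx_alg.
  by exists e => //; apply: elementary_mem eE.
exists (g' * e)%g; first by rewrite groupM.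
rewrite FinRing.val_unitM g'E eE mulrDl mul1r mulrDr mulr1 -scalerAr A'E scaler0 addr0.
by rewrite [in RHS]AE -addrA [c *: _ + A']addrC.
Qed.

Lemma path_group_generated : U S \subset P.
Proof.
apply/subsetP => g; rewrite mem_path_group => /path_alg_generated[g' g'P e].
suff -> : g = g' by [].
by apply: val_inj; rewrite e addrC subrK.
Qed.

End Generation.
End PathGenerators.

(** * Spectral gap in codimension two *)

Lemma sum_shift (R : nmodType) (F : finFieldType) (f : F -> R) a :
  \sum_c f (c + a) = \sum_c f c.
Proof. by rewrite [RHS](reindex_inj (addIr a)). Qed.

Section LinePoint.
Variables (R : realFieldType) (F : finFieldType) (Phi : F -> F -> R).
Hypothesis Phi0 : \sum_a \sum_c Phi a c = 0.

Let line_sum b c := \sum_a Phi a (c - a * b).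

(** The map from [(b, c)] to [(c - a * b, c - a' * b)] is bijective: two points with different first
    coordinates lie on exactly one line. *)
Lemma line_sum_cross a a' : a != a' ->
  \sum_b \sum_c Phi a (c - a * b) * Phi a' (c - a' * b) =
  (\sum_c Phi a c) * (\sum_c Phi a' c).
Proof.
move=> aa'; transitivity (\sum_b \sum_c Phi a c * Phi a' (c + (a - a') * b)).
  apply: eq_bigr => b _; rewrite -(sum_shift _ (a * b)); apply: eq_bigr => c _.
  by congr (Phi _ _ * Phi _ _); ring.
rewrite exchange_big /= mulr_suml; apply: eq_bigr => c _; rewrite -mulr_sumr.
congr (_ * _); rewrite [RHS](reindex (fun b => c + (a - a') * b)) //=.
exists (fun e => (e - c) / (a - a')) => b _; last by field; rewrite subr_eq0.
by rewrite addrC addKr mulrC mulKf ?subr_eq0.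
Qed.

(** The diagonal terms give the right-hand side. The others are the products [s a * s a'] with
    [a != a']; they add up to minus the sum of the [s a ^+ 2], since the [s a] sum to zero. *)
Lemma line_sum_sqr :
  \sum_b \sum_c line_sum b c ^+ 2 <= #|F|%:R * \sum_a \sum_c Phi a c ^+ 2.
Proof.
have -> : \sum_b \sum_c line_sum b c ^+ 2 =
    \sum_a \sum_a' \sum_b \sum_c Phi a (c - a * b) * Phi a' (c - a' * b).
  transitivity (\sum_b \sum_c \sum_a \sum_a' Phi a (c - a * b) * Phi a' (c - a' * b)).
    apply: eq_bigr => b _; apply: eq_bigr => c _; rewrite expr2 mulr_suml.
    by apply: eq_bigr => a _; rewrite mulr_sumr.
  transitivity (\sum_b \sum_a \sum_c \sum_a' Phi a (c - a * b) * Phi a' (c - a' * b)).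
    by apply: eq_bigr => b _; rewrite exchange_big.
  rewrite exchange_big /=; apply: eq_bigr => a _.
  transitivity (\sum_b \sum_a' \sum_c Phi a (c - a * b) * Phi a' (c - a' * b)).
    by apply: eq_bigr => b _; rewrite exchange_big.
  by rewrite exchange_big.
pose s a := \sum_c Phi a c.
have -> : #|F|%:R * (\sum_a \sum_c Phi a c ^+ 2) =
    \sum_a (#|F|%:R * (\sum_c Phi a c ^+ 2) + s a * \sum_a' s a').
  by rewrite big_split /= -mulr_sumr -mulr_suml /s Phi0 mulr0 addr0.
apply: ler_sum => a _; rewrite (bigD1 a) //= [X in s a * X](bigD1 a) //= mulrDr addrA.
rewrite [X in _ + X <= _](eq_bigr (fun a' => s a * s a')) => [|a' a'a]; last first.
  by rewrite line_sum_cross // eq_sym.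
rewrite -mulr_sumr lerD2r -expr2 -[leLHS]addr0 lerD ?sqr_ge0 //.
rewrite (eq_bigr (fun=> \sum_c Phi a c ^+ 2)) => [|b _].
  by rewrite sumr_const mulr_natl.
rewrite -(sum_shift _ (a * b)); apply: eq_bigr => c _.
by rewrite addrK expr2.
Qed.

End LinePoint.

(** In these Heisenberg coordinates, cosets of [A] are points [(a, c - a * b)] and cosets of [B] are
    lines [(b, c)], so the correlation pairs [psi] with the line sums of [phi]. *)
Lemma heisenberg_gap (R : realType) (F : finFieldType) (gT : finGroupType)
    (H A B : {set gT}) (h : F * F * F -> gT) (eps : R) :
  0 < eps -> 1 <= eps ^+ 2 * #|F|%:R -> injective h -> H = [set h t | t in setT] ->
  (forall b', exists2 y, y \in A & forall a b c, (h (a, b, c) * y)%g = h (a, b + b', c + a * b')) ->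
  (forall a', exists2 y, y \in B & forall a b c, (h (a, b, c) * y)%g = h (a + a', b, c)) ->
  coset_gap H A B eps.
Proof.
move=> e0 eF injh HE hA hB phi psi phiA psiB phi0 psi0.
have hH t : h t \in H by rewrite HE imset_f ?inE.
have sumH (f : gT -> R) : \sum_(x in H) f x = \sum_a \sum_b \sum_c f (h (a, b, c)).
  rewrite HE big_imset /=; last by move=> ? ? _ _ /injh.
  rewrite [RHS]pair_bigA /= [RHS]pair_bigA /=.
  by apply: eq_big => [t|[[a b] c] _] //; rewrite inE.
pose Phi a c := phi (h (a, 0, c)); pose Psi b c := psi (h (0, b, c)).
have phiE a b c : phi (h (a, b, c)) = Phi a (c - a * b).
  have [y yA yE] := hA b; by rewrite /Phi -[RHS](phiA _ y (hH _) yA) yE add0r subrK.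
have psiE a b c : psi (h (a, b, c)) = Psi b c.
  by have [y yB yE] := hB a; rewrite /Psi -[RHS](psiB _ y (hH _) yB) yE add0r.
set q : R := #|F|%:R in eF *.
have q0 : 0 < q by rewrite ltr0n; apply/card_gt0P; exists 0.
have cF (c : R) : \sum_(a : F) c = c * q by rewrite sumr_const mulr_natr.
have sum_phi (f : R -> R) : \sum_(x in H) f (phi x) = q * \sum_a \sum_c f (Phi a c).
  rewrite sumH mulr_sumr; apply: eq_bigr => a _.
  rewrite (eq_bigr (fun=> \sum_c f (Phi a c))) => [|b _]; first by rewrite cF mulrC.
  by rewrite -[LHS](sum_shift _ (a * b)); apply: eq_bigr => c _; rewrite phiE addrK.
have sum_psi (f : R -> R) : \sum_(x in H) f (psi x) = q * \sum_b \sum_c f (Psi b c).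
  rewrite sumH (eq_bigr (fun=> \sum_b \sum_c f (Psi b c))) => [|a _].
    by rewrite cF mulrC.
  by apply: eq_bigr => b _; apply: eq_bigr => c _; rewrite psiE.
have Phi0 : \sum_a \sum_c Phi a c = 0.
  by apply: (mulfI (lt0r_neq0 q0)); rewrite mulr0 -(sum_phi id).
pose L b c := \sum_a Phi a (c - a * b).
have LE : \sum_(x in H) phi x * psi x = \sum_b \sum_c L b c * Psi b c.
  rewrite sumH exchange_big /=; apply: eq_bigr => b _.
  rewrite exchange_big /=; apply: eq_bigr => c _; rewrite mulr_suml.
  by apply: eq_bigr => a _; rewrite phiE psiE.
rewrite LE (sum_phi (fun x => x ^+ 2)) (sum_psi (fun x => x ^+ 2)).
have LL := line_sum_sqr Phi0; rewrite -/q in LL.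
set SP := \sum_a \sum_c Phi a c ^+ 2 in LL *.
have SP0 : 0 <= SP by apply: sumr_ge0 => a _; apply: sumr_ge0 => c _; apply: sqr_ge0.
have eq0 : 0 < eps * q by rewrite mulr_gt0.
(* The weight [eps * q] matches the target on the [Psi] side; on the other, [line_sum_sqr] leaves
   [SP / eps], which is at most [eps * q * SP] because [1 <= eps ^+ 2 * q]. *)
have step : 2 * (\sum_b \sum_c L b c * Psi b c) <=
    eps * q * (\sum_b \sum_c Psi b c ^+ 2) + (\sum_b \sum_c L b c ^+ 2) / (eps * q).
  rewrite !mulr_sumr mulr_suml -big_split /=; apply: ler_sum => b _.
  rewrite !mulr_sumr mulr_suml -big_split /=; apply: ler_sum => c _.
  rewrite -subr_ge0.
  have -> : eps * q * Psi b c ^+ 2 + L b c ^+ 2 / (eps * q) - 2 * (L b c * Psi b c) =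
     (eps * q * Psi b c - L b c) ^+ 2 / (eps * q) by field; rewrite !lt0r_neq0.
  by rewrite divr_ge0 ?sqr_ge0 ?ltW.
apply: (le_trans step); rewrite mulrDr addrC [eps * (q * SP)]mulrA [X in _ <= _ + X]mulrA lerD2r.
rewrite ler_pdivrMr //; apply: (le_trans LL).
have : 0 <= q * SP * (eps ^+ 2 * q - 1) by rewrite mulr_ge0 ?mulr_ge0 ?subr_ge0 // ltW.
by move=> pos; rewrite -subr_ge0; move: pos; congr (0 <= _); ring.
Qed.

(** Here [phi] depends only on [a] and [psi] only on [b]: the graph is complete bipartite, and the
    correlation factors into two sums, of which the first is zero. *)
Lemma abelian_gap (R : realType) (F : finFieldType) (gT : finGroupType)
    (H A B : {set gT}) (h : F * F -> gT) (eps : R) :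
  0 <= eps -> injective h -> H = [set h t | t in setT] ->
  (forall b', exists2 y, y \in A & forall a b, (h (a, b) * y)%g = h (a, b + b')) ->
  (forall a', exists2 y, y \in B & forall a b, (h (a, b) * y)%g = h (a + a', b)) ->
  coset_gap H A B eps.
Proof.
move=> e0 injh HE hA hB phi psi phiA psiB phi0 psi0.
have hH t : h t \in H by rewrite HE imset_f ?inE.
have sumH (f : gT -> R) : \sum_(x in H) f x = \sum_a \sum_b f (h (a, b)).
  rewrite HE big_imset /=; last by move=> ? ? _ _ /injh.
  by rewrite [RHS]pair_bigA /=; apply: eq_big => [t|[a b] _] //; rewrite inE.
have phiE a b : phi (h (a, b)) = phi (h (a, 0)).
  by have [y yA yE] := hA b; rewrite -[RHS](phiA _ y (hH _) yA) yE add0r.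
have psiE a b : psi (h (a, b)) = psi (h (0, b)).
  by have [y yB yE] := hB a; rewrite -[RHS](psiB _ y (hH _) yB) yE add0r.
have q0 : #|F|%:R != 0 :> R by rewrite pnatr_eq0 -lt0n; apply/card_gt0P; exists 0.
have s0 : \sum_a phi (h (a, 0)) = 0.
  apply: (mulIf q0); rewrite mul0r -[RHS]phi0 sumH mulr_suml; apply: eq_bigr => a _.
  by rewrite (eq_bigr (fun=> phi (h (a, 0)))) ?sumr_const ?mulr_natr.
have -> : \sum_(x in H) phi x * psi x = 0.
  rewrite sumH; transitivity ((\sum_a phi (h (a, 0))) * (\sum_b psi (h (0, b)))).
    rewrite mulr_suml; apply: eq_bigr => a _; rewrite mulr_sumr.
    by apply: eq_bigr => b _; rewrite phiE psiE.
  by rewrite s0 mul0r.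
by rewrite mulr0 mulr_ge0 ?addr_ge0 ?sumr_ge0 // => x _; apply: sqr_ge0.
Qed.

Lemma residue_add_neq m' (p : 'I_m'.+1) k : (0 < k < m'.+1)%N ->
  (residue m' (p + k) == p) = false.
Proof.
move=> /andP[k0 km]; rewrite -[X in _ == X]residue_id eq_residue.
by rewrite -[X in _ == X %[mod _]]addn0 eqn_modDl mod0n modn_small // gtn_eqF.
Qed.

Lemma coset_gap_sym (R : realType) (gT : finGroupType) (H A B : {set gT}) (eps : R) :
  coset_gap H A B eps -> coset_gap H B A eps.
Proof.
move=> gap phi psi phiB psiA phi0 psi0; rewrite addrC.
rewrite (eq_bigr (fun x => psi x * phi x)) => [|x _]; last by rewrite mulrC.
exact: gap.
Qed.

(** * Links of codimension two of the path groups *)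

Section PathGap.
Variables (R : realType) (F : finFieldType) (n m' : nat).
Local Notation m := m'.+1.
Local Notation mat := 'M[F]_n.+1.
Local Notation gT := {unit mat}.
Hypotheses (n_large : (m.*2 <= n.+1)%N) (m_ge3 : (2 < m)%N).
Local Notation E := (@path_mx F n m').
Local Notation U := (@path_group F n m').
Variables (i j : 'I_m) (eps : R).
Hypothesis ij : i != j.
Let S := ~: [set i; j].

Let S_neq0 : S != set0.
Proof. by rewrite -card_gt0 /S cardsCs setCK card_ord cards2 ij subn_gt0. Qed.

Let mulE (a b : 'I_m) (p q : nat) :
  E a p * E b q = if residue m' (a + p) == b then E a (p + q) else 0.
Proof. exact: path_mxM. Qed.

Let not_crosses1 (T : {set 'I_m}) (r : 'I_m) : r \notin T -> ~~ crosses T r 1.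
Proof. by rewrite crosses1 residue_id. Qed.

Let alg (T : {set 'I_m}) (r : 'I_m) c d : (0 < d)%N -> ~~ crosses T r d -> path_alg T (c *: E r d).
Proof. by move=> ? ?; rewrite path_algZ // path_mx_alg. Qed.

Let iS : i \notin S. Proof. by rewrite !inE eqxx. Qed.
Let jS : j \notin S. Proof. by rewrite !inE eqxx orbT. Qed.

Let residue1 (p : 'I_m) : (residue m' (p + 1) == p) = false.
Proof. by rewrite residue_add_neq // (ltnW m_ge3). Qed.

Let residue2 (p : 'I_m) : (residue m' (p + 2) == p) = false.
Proof. by rewrite residue_add_neq // m_ge3. Qed.

Let not_crosses (r : 'I_m) d e : ~~ crosses S r d -> (e < d)%N ->
  (residue m' (r + e) == i) || (residue m' (r + e) == j).
Proof.
move=> nc ed; move: nc; apply: contraNT => ne; apply/crossesP; exists e => //.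
by rewrite !inE.
Qed.

(** Three consecutive arrows are distinct on a cycle with at least three, and only [i] and [j] are
    allowed. *)
Let not_crosses3 (r : 'I_m) d : ~~ crosses S r d -> (d < 3)%N.
Proof.
move=> nc; rewrite ltnNge; apply/negP => d3.
have c0 := not_crosses nc (leq_trans (ltn0Sn 2) d3).
have c1 := not_crosses nc (leq_trans (isT : (1 < 3)%N) d3).
have c2 := not_crosses nc (leq_trans (isT : (2 < 3)%N) d3).
have n1 := residue1 r; have n2 := residue2 r.
have n3 : (residue m' (r + 2) == residue m' (r + 1)) = false.
  have -> : residue m' (r + 2) = residue m' (residue m' (r + 1) + 1) by rewrite residueD -addnA.
  exact: residue1.
move: c0 c1 c2; rewrite addn0 residue_id.
by case/orP => /eqP e0; case/orP => /eqP e1; case/orP => /eqP e2;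
  rewrite ?e2 ?e1 ?e0 ?eqxx in n1 n2 n3.
Qed.

(** The surviving paths are [i], [j] and [i] followed by [j]. The only nonzero product among them is
    [E i 1 * E j 1 = E i 2], which is the Heisenberg law in the coordinates of [heisenberg_gap]. *)
Lemma path_gap_adjacent : residue m' (i + 1) = j -> 0 < eps -> 1 <= eps ^+ 2 * #|F|%:R ->
  coset_gap (U S) (U (i |: S)) (U (j |: S)) eps.
Proof.
move=> ei e0 eF.
have ej : (residue m' (j + 1) == i) = false.
  by rewrite -ei residueD -addnA residue2.
have ei2 : residue m' (i + 2) = residue m' (j + 1) by rewrite -ei residueD -addnA.
have nc2 : ~~ crosses S i 2.
  by rewrite -[2%N]/(1 + 1)%N crossesD !crosses1 residue_id ei negb_or iS jS.
pose N (t : F * F * F) : mat := t.1.1 *: E i 1 + t.1.2 *: E j 1 + t.2 *: E i 2.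
have PN t : path_alg S (N t) by rewrite !path_algD ?alg ?not_crosses1.
have /fin_all_exists2[h hU hE] t := path_unit (PN t).
have coefN t : [/\ coef (N t) i 1 = t.1.1, coef (N t) j 1 = t.1.2 & coef (N t) i 2 = t.2].
  rewrite /N !coefD !coefZ !coef_path_mx ?m_ge3 ?(ltnW m_ge3) //.
  rewrite !eqxx (negPf ij) [j == i]eq_sym (negPf ij) /= !mulr0 !mulr1 !addr0 !add0r.
  by split.
apply: (heisenberg_gap (h := h) e0 eF).
- move=> t t' e; have : N t = N t' by apply: (addrI 1); rewrite -!hE e.
  move=> Nt; have [a1 b1 c1] := coefN t; have [a2 b2 c2] := coefN t'.
  have aE : t.1.1 = t'.1.1 by rewrite -a1 -a2 Nt.
  have bE : t.1.2 = t'.1.2 by rewrite -b1 -b2 Nt.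
  have cE : t.2 = t'.2 by rewrite -c1 -c2 Nt.
  by case: t t' aE bE cE {e Nt a1 b1 c1 a2 b2 c2} => [[a b] c] [[a' b'] c'] /= -> -> ->.
- apply/setP => x; apply/idP/imsetP => [xS|[t _ ->]]; last exact: hU.
  rewrite mem_path_group in xS; set A := val x - 1 in xS.
  pose t := (coef A i 1, coef A j 1, coef A i 2).
  exists t; rewrite ?inE //; apply: val_inj; rewrite hE.
  suff <- : A = N t by rewrite addrC subrK.
  apply: (path_alg_eq n_large S_neq0 xS (PN t)) => r d /andP[d0 dm] nc.
  have d3 := not_crosses3 nc; have [c1 c2 c3] := coefN t.
  have := not_crosses nc d0; rewrite addn0 residue_id.
  have [d1|d1] := eqVneq d 1%N; first by rewrite d1 => /orP[/eqP ->|/eqP ->]; rewrite ?c1 ?c2.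
  have d2 : d = 2%N by move: (d) d0 d1 d3; do 3?case=> //.
  rewrite d2 => /orP[/eqP ->|/eqP rj]; first by rewrite c3.
  have : (1 < d)%N by rewrite d2.
  move/(not_crosses nc); by rewrite rj ej residue1.
- move=> b'; have [|y yU yE] := @path_unit F n m' (i |: S) (b' *: E j 1).
    by apply: alg => //; apply: not_crosses1; rewrite !inE eqxx orbT orbF eq_sym.
  exists y => // a b c; apply: val_inj; rewrite FinRing.val_unitM !hE yE /N /=.
  rewrite mulrDl mul1r mulrDr mulr1 !mulrDl -!scalerAl -!scalerAr !mulE ei eqxx.
  rewrite residue1 ei2 residue1.
  by apply/matrixP => u v; rewrite !mxE; ring.
- move=> a'; have [|y yU yE] := @path_unit F n m' (j |: S) (a' *: E i 1).
    by apply: alg => //; apply: not_crosses1; rewrite !inE eqxx orbF.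
  exists y => // a b c; apply: val_inj; rewrite FinRing.val_unitM !hE yE /N /=.
  rewrite mulrDl mul1r mulrDr mulr1 !mulrDl -!scalerAl -!scalerAr !mulE ei2 ej residue1.
  by apply/matrixP => u v; rewrite !mxE; ring.
Qed.

(** No path of length two survives, so all products vanish and the group is the additive group of
    pairs of coefficients. *)
Lemma path_gap_nonadjacent : residue m' (i + 1) != j -> residue m' (j + 1) != i -> 0 <= eps ->
  coset_gap (U S) (U (i |: S)) (U (j |: S)) eps.
Proof.
move=> /negPf ei /negPf ej e0.
pose N (t : F * F) : mat := t.1 *: E i 1 + t.2 *: E j 1.
have PN t : path_alg S (N t) by rewrite !path_algD ?alg ?not_crosses1.
have /fin_all_exists2[h hU hE] t := path_unit (PN t).
have coefN t : coef (N t) i 1 = t.1 /\ coef (N t) j 1 = t.2.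
  rewrite /N !coefD !coefZ !coef_path_mx ?(ltnW m_ge3) //.
  by rewrite !eqxx (negPf ij) [j == i]eq_sym (negPf ij) /= !mulr0 !mulr1 !addr0 !add0r.
apply: (abelian_gap (h := h) e0).
- move=> t t' e; have : N t = N t' by apply: (addrI 1); rewrite -!hE e.
  move=> Nt; have [a1 b1] := coefN t; have [a2 b2] := coefN t'.
  have aE : t.1 = t'.1 by rewrite -a1 -a2 Nt.
  have bE : t.2 = t'.2 by rewrite -b1 -b2 Nt.
  by case: t t' aE bE {e Nt a1 b1 a2 b2} => [a b] [a' b'] /= -> ->.
- apply/setP => x; apply/idP/imsetP => [xS|[t _ ->]]; last exact: hU.
  rewrite mem_path_group in xS; set A := val x - 1 in xS.
  pose t := (coef A i 1, coef A j 1).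
  exists t; rewrite ?inE //; apply: val_inj; rewrite hE.
  suff <- : A = N t by rewrite addrC subrK.
  apply: (path_alg_eq n_large S_neq0 xS (PN t)) => r d /andP[d0 dm] nc.
  have [c1 c2] := coefN t.
  have := not_crosses nc d0; rewrite addn0 residue_id.
  have [d1|d1] := eqVneq d 1%N; first by rewrite d1 => /orP[/eqP ->|/eqP ->]; rewrite ?c1 ?c2.
  have d2 : (1 < d)%N by rewrite ltn_neqAle eq_sym d1.
  have := not_crosses nc d2.
  by move=> H /orP[] /eqP re; move: H; rewrite re ?ei ?ej residue1.
- move=> b'; have [|y yU yE] := @path_unit F n m' (i |: S) (b' *: E j 1).
    by apply: alg => //; apply: not_crosses1; rewrite !inE eqxx orbT orbF eq_sym.
  exists y => // a b; apply: val_inj; rewrite FinRing.val_unitM !hE yE /N /=.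
  rewrite mulrDl mul1r mulrDr mulr1 !mulrDl -!scalerAl -!scalerAr !mulE ei residue1.
  by apply/matrixP => u v; rewrite !mxE; ring.
- move=> a'; have [|y yU yE] := @path_unit F n m' (j |: S) (a' *: E i 1).
    by apply: alg => //; apply: not_crosses1; rewrite !inE eqxx orbF.
  exists y => // a b; apply: val_inj; rewrite FinRing.val_unitM !hE yE /N /=.
  rewrite mulrDl mul1r mulrDr mulr1 !mulrDl -!scalerAl -!scalerAr !mulE ej residue1.
  by apply/matrixP => u v; rewrite !mxE; ring.
Qed.

End PathGap.

Section PathFamily.
Variables (R : realType) (F : finFieldType) (n m' : nat).
Local Notation m := m'.+1.
Local Notation mat := 'M[F]_n.+1.
Local Notation gT := {unit mat}.
Hypotheses (n_large : (m.*2 <= n.+1)%N) (m_ge3 : (2 < m)%N).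
Local Notation U := (@path_group F n m').
Local Notation K := (@path_family F n m').

Theorem path_coset_family (eps : R) : 0 < eps -> 1 <= eps ^+ 2 * #|F|%:R ->
  coset_family K eps.
Proof.
move=> e0 eF; split=> [S T||S i j l x z ij jl il||S i j ij SE].
- exact: path_family_meet.
- exact: path_family_setT.
- by rewrite !path_familyU1; apply: path_flag.
- move=> S Sm; have [->|S0] := eqVneq S set0.
    apply: subset_trans (subsetIl _ _) _; rewrite gen_subG.
    apply/bigcupsP => l _; apply/subsetP => x xl; apply/mem_gen/bigcupP.
    by exists l; rewrite ?path_familyU1 ?setU0 // in_setC in_set0.
  rewrite path_family_neq0 //; apply: subset_trans (path_group_generated F n_large S0 Sm) _.
  rewrite gen_subG; apply/bigcupsP => l lS; apply/subsetP => x xl.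
  by apply/mem_gen/bigcupP; exists l; rewrite ?path_familyU1.
- have S0 : S != set0.
    by rewrite -card_gt0 SE cardsCs setCK card_ord cards2 ij subn_gt0.
  suff : coset_gap (U S) (U (i |: S)) (U (j |: S)) eps.
    have KS := path_family_neq0 F n S0.
    have KiS := path_familyU1 F n i S; have KjS := path_familyU1 F n j S.
    by rewrite -KS -KiS -KjS.
  rewrite SE; have [ei|ei] := eqVneq (residue m' (i + 1)) j; first exact: path_gap_adjacent.
  have [ej|ej] := eqVneq (residue m' (j + 1)) i.
    rewrite setUC; apply: coset_gap_sym; apply: path_gap_adjacent => //.
    by rewrite eq_sym.
  by apply: path_gap_nonadjacent => //; apply: ltW.
Qed.

(** Multiply the elements [1 + E1 k] for [k < t]. In row 0 the last nonzero entry is at column [t],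
    so the [n + 1] products are distinct; each factor lies in a one-arrow group. *)
Lemma path_family_order : (n < #|K set0|)%N.
Proof.
pose E1 k := @path_mx F n m' (residue m' k) 1.
have E1_alg k l : l != residue m' k -> path_alg [set l] (E1 k).
  by move=> lk; rewrite path_mx_alg // crosses1 residue_id inE eq_sym.
have [other ne] : exists f : nat -> 'I_m, forall k, f k != residue m' k.
  exists (fun k => residue m' (k + 1)) => k.
  by rewrite -residueD residue_add_neq // (ltnW m_ge3).
have u_ex k : exists2 g, g \in U [set other k] & val g = 1 + E1 k.
  by apply: path_unit; apply: E1_alg.
have walk t : exists2 g, g \in K set0 &
    forall v : 'I_n.+1, (t <= v)%N -> (val g) ord0 v = (v == t :> nat)%:R.
  elim: t => [|t [g gK gv]].
    exists 1%g => // v _; rewrite /= mxE -(inj_eq val_inj) /= eq_sym //.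
  have [u uU uE] := u_ex t; exists (g * u)%g.
    rewrite groupM //; apply: (subsetP (_ : U [set other t] \subset K set0)) => //.
    rewrite -path_family_neq0; last by apply/set0Pn; exists (other t); rewrite inE.
    rewrite -[[set other t]]setU0 path_family_meet; exact: subsetIr.
  move=> v tv; rewrite FinRing.val_unitM uE mulrDr mulr1 mxE gv; last exact: ltnW.
  have v1 : (v.-1 < n.+1)%N by apply: leq_ltn_trans (ltn_ord v); apply: leq_pred.
  rewrite -mulmxE mxE (bigD1 (Ordinal v1)) //= big1 => [|w wv]; last first.
    rewrite [E1 t w v]mxE (_ : (v == _ :> nat) = false) ?andbF ?mulr0 //.
    by apply: contraNF wv => /eqP e; apply/eqP/val_inj; rewrite /= e addn1.
  rewrite gv /=; last by case: (v : nat) tv.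
  rewrite mxE /= addr0 addn1 prednK ?eqxx ?andbT; last by case: (v : nat) tv.
  case: v tv {v1} => -[//|v] vn /= tv; rewrite eqSS gtn_eqF // add0r.
  have [->|//] := eqVneq v t; last by rewrite mul0r.
  by rewrite eqxx mulr1.
have /fin_all_exists2[h hK hv] (t : 'I_n.+1) := walk t.
rewrite -[X in (X <= _)%N](card_ord n.+1) -[X in (X <= _)%N]cardsT.
have injh : injective h.
  move=> t t'; wlog tt' : t t' / (t <= t')%N.
    by move=> W; case/orP: (leq_total t t') => ? ?; [apply: W | apply/esym/W].
  move=> e; have := hv t t' tt'; rewrite e hv // eqxx.
  by case: eqP => [e' _|_ /eqP]; [apply/val_inj | rewrite oner_eq0].
rewrite -(card_imset _ injh); apply: subset_leq_card.
by apply/subsetP => _ /imsetP[t _ ->].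
Qed.

End PathFamily.

(** * Orders of the groups and the main theorem *)

(** Coefficient vectors indexed by start and length below [m], with no reference to [n]: counting
    them shows that the order of a group with nonempty [S] is the same for every truncation. *)
Definition path_coefs (F : finFieldType) m' (S : {set 'I_m'.+1}) :
    {set {ffun 'I_m'.+1 * 'I_m'.+1 -> F}} :=
  [set c : {ffun 'I_m'.+1 * 'I_m'.+1 -> F} | [forall rd : 'I_m'.+1 * 'I_m'.+1, ((rd.2 == 0%N :> nat) || crosses S rd.1 rd.2) ==> (c rd == 0)]].

Section PathCard.
Variables (F : finFieldType) (n m' : nat).
Local Notation m := m'.+1.
Hypothesis n_large : (m.*2 <= n.+1)%N.
Local Notation E := (@path_mx F n m').
Local Notation U := (@path_group F n m').

Lemma coef_sum (I : finType) (A : I -> 'M[F]_n.+1) r d :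
  coef (\sum_i A i) r d = \sum_i coef (A i) r d.
Proof. by rewrite /coef summxE. Qed.

Lemma card_path_group (S : {set 'I_m}) : S != set0 -> #|U S| = #|path_coefs F S|.
Proof.
move=> S0; pose f (g : {unit 'M[F]_n.+1}) : {ffun 'I_m * 'I_m -> F} :=
  [ffun rd : 'I_m * 'I_m => coef (val g - 1) rd.1 rd.2].
have injf : {in U S &, injective f}.
  move=> x y; rewrite !mem_path_group => xS yS /ffunP e; apply: val_inj.
  apply: (addIr (-1)); apply: (path_alg_eq n_large S0 xS yS) => r d /andP[_ dm] _.
  by have := e (r, Ordinal dm); rewrite !ffunE.
rewrite -(card_in_imset injf); apply: eq_card => c; apply/imsetP/idP.
  case=> g; rewrite mem_path_group => gS ->; rewrite inE; apply/forallP => -[r d] /=.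
  apply/implyP; rewrite ffunE /=; have [d0 _|d0 /= cr] := eqVneq (d : nat) 0%N.
    by rewrite d0 /coef (path_alg_eq0 gS) // addn0 leqnn.
  apply: contraTT cr; apply: (path_mx_long n_large S0 gS).
  by rewrite lt0n d0 ltn_ord.
rewrite inE => /forallP c0; pose A : 'M[F]_n.+1 := \sum_(rd : 'I_m * 'I_m) c rd *: E rd.1 rd.2.
have PA : path_alg S A.
  rewrite /A; elim/big_ind: _ => [|B C|[r d] _]; [exact: path_alg0 | exact: path_algD |].
  have [cz|cz] := eqVneq (c (r, d)) 0; first by rewrite cz scale0r path_alg0.
  have := c0 (r, d); rewrite (negPf cz) implybF negb_or -lt0n => /andP[d0 nc].
  by rewrite path_algZ // path_mx_alg.
have [g gS gE] := path_unit PA; exists g => //; apply/ffunP => -[r d]; rewrite ffunE /=.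
rewrite gE addrC addKr coef_sum (bigD1 (r, d)) //= big1 => [|[r' d'] ne].
  by rewrite coefZ (coef_path_mx F n_large) // !eqxx mulr1 addr0.
rewrite coefZ (coef_path_mx F n_large) //=; case: eqP => [e1|_]; last by rewrite mulr0.
case: eqP => [e2|_]; last by rewrite mulr0.
by case/eqP: ne; rewrite e1; congr pair; apply: val_inj.
Qed.

End PathCard.

Definition sym_card (F : finFieldType) m' (S : {set 'I_m'.+1}) :=
  (\prod_(s <- index_enum {perm 'I_m'.+1}) #|path_coefs F (s @: S)|)%N.

Lemma sym_card_invariant (F : finFieldType) m' (S T : {set 'I_m'.+1}) :
  #|S| = #|T| -> sym_card F S = sym_card F T.
Proof.
apply: perm_invariant_card => s {}S; rewrite /sym_card.
rewrite [RHS](reindex_inj (mulgI s)) /=; apply: eq_bigr => t _.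
have -> // : (s * t)%g @: S = t @: (s @: S).
by rewrite -imset_comp; apply: eq_imset => x; rewrite /= permM.
Qed.

Definition sym_order (F : finFieldType) m' k := sym_card F [set i : 'I_m'.+1 | (i < k)%N].

Lemma card_initial m k : (k <= m)%N -> #|[set i : 'I_m | (i < k)%N]| = k.
Proof.
by move=> km; rewrite -sum1_card (eq_bigl (fun i : 'I_m => (i < k)%N)) ?(big_ord_narrow km) ?sum1_card ?card_ord // => i; rewrite inE.
Qed.

Lemma symmetric_family (R : realType) (F : finFieldType) m' (eps : R) s :
  (2 < m'.+1)%N -> 0 < eps -> 1 <= eps ^+ 2 * #|F|%:R ->
  exists (gT : finGroupType) (K : {set 'I_m'.+1} -> {group gT}),
  [/\ coset_family K eps, (s <= #|K set0|)%N &
    forall S, S != set0 -> #|K S| = sym_order F m' #|S|].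
Proof.
(* The summand [2m] makes the coefficients readable, and [s] makes [K set0] large. *)
move=> m3 e0 eF; pose n := (s + m'.+1.*2)%N.
have n_large : (m'.+1.*2 <= n.+1)%N by rewrite leqW // leq_addl.
have fam := path_coset_family n_large m3 e0 eF.
have [gT [K [famK cardK]]] := coset_family_prod_perm (index_enum {perm 'I_m'.+1}) (ltW e0) fam.
exists gT, K; split=> //.
  rewrite cardK; have s0 (t : {perm 'I_m'.+1}) : t @: set0 = set0 by rewrite imset0.
  under eq_bigr do rewrite s0.
  rewrite (bigD1 1%g) //; apply: (leq_trans _ (leq_pmulr _ _)).
    apply: (leq_trans _ (ltnW (path_family_order F n m3))); exact: leq_addr.
  by apply: prodn_gt0 => t; rewrite cardG_gt0.
move=> S S0; rewrite cardK /sym_order -(@sym_card_invariant F m' S).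
  apply: eq_bigr => t _; rewrite path_family_neq0 ?card_path_group //.
    by rewrite -card_gt0 card_imset ?card_gt0 //; apply: perm_inj.
  by rewrite -card_gt0 card_imset ?card_gt0 //; apply: perm_inj.
by rewrite card_initial // -[X in (_ <= X)%N]card_ord max_card.
Qed.

Lemma regular_expander (R : realType) (lam : R) n t p s : (0 < n)%N -> (n.+2 < t)%N ->
  (t - n.+2)%:R^-1 <= lam -> prime p -> (t ^ 2 <= p)%N ->
  let c := sym_order 'F_p n.+1 in
  let d k := ((n.+2 - k.+1) * c k.+1 %/ c k.+2)%N in
  exists G : {N & rel 'I_N},
    let adj := projT2 G in
    [/\ simple_graph adj, regular_seq adj n d, (s <= projT1 G * c 1)%N,
        local_spectral_expander adj lam &
        forall k, (k.+1 < n.+2)%N -> (0 < d k)%N /\ (d k.+1 < d k)%N].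
Proof.
move=> n0 mt tlam pp tp c d; pose eps : R := t%:R^-1.
have t0 : 0 < t%:R :> R by rewrite ltr0n (leq_trans _ mt).
have e0 : 0 < eps by rewrite invr_gt0.
have eF : 1 <= eps ^+ 2 * #|'F_p|%:R.
  by rewrite card_Fp // exprVn mulrC ler_pdivlMr ?exprn_gt0 // mul1r -natrX ler_nat.
have [gT [K [famK K0 cardK]]] := @symmetric_family R 'F_p n.+1 eps s n0 e0 eF.
(* Only [M 0] depends on [s]. The degrees [d] read [c] from index 1 on, so one tuple fits every
   graph. *)
pose M k := if k is k'.+1 then c k'.+1 else #|K set0|.
have cardM (S : {set 'I_n.+2}) : #|K S| = M #|S|.
  have [->|S0] := eqVneq S set0; first by rewrite cards0.
  rewrite cardK //; move: S0; rewrite -card_gt0 /M.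
  by case: #|S|.
exists (existT (fun N => rel 'I_N) (cg_size K) (@cg_adj gT _ K)); rewrite /=.
have dE k : d k = cg_degree n.+2 M k.+1 by [].
split.
- by split; [exact: cg_sym | exact: cg_irr].
- exact: (cg_regular ord0 famK cardM).
- exact: leq_trans K0 (cg_size_ge ord0 famK cardM).
- exact: (cg_local_spectral_expander ord0 famK cardM (erefl _) _ mt tlam).
- move=> k km; rewrite !dE; split.
    by apply: (cg_degree_gt0 ord0 famK cardM).
  exact: (cg_degree_decr ord0 famK cardM).
Qed.

Theorem mainTheorem1 (R : realType) (lam : R) (n : nat) :
  0 < lam -> (0 < n)%N ->
  exists (d : nat -> nat) (N : nat -> nat) (adj : forall s : nat, rel 'I_(N s)),
    (forall i, (i.+1 < n)%N -> (d i.+1 < d i)%N) /\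
    (0 < d n.-1)%N /\
    (forall s, simple_graph (adj s)) /\
    (forall s, regular_seq (adj s) n d) /\
    (forall M : nat, exists s0, forall s, (s0 <= s)%N -> (M <= N s)%N) /\
    (forall s, local_spectral_expander (adj s) lam).
Proof.
move=> lam0 n0; have [k lamk] : exists k, lam^-1 < k.+1%:R.
  exists (Num.bound lam^-1); apply: lt_le_trans (archi_boundP _) _.
    by rewrite invr_ge0 ltW.
  by rewrite ler_nat.
(* [t - n.+2 = k.+1] exceeds [lam^-1], and a prime above [t ^ 2] gives [p^(-1/2) <= 1/t] in
   codimension two. *)
pose t := (n.+2 + k.+1)%N; have [p tp pp] := prime_above (t ^ 2).
have mt : (n.+2 < t)%N by rewrite /t addnS ltnS leq_addr.
have tlam : (t - n.+2)%:R^-1 <= lam.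
  by rewrite /t addKn invf_ple ?posrE // ltW.
have [G GP] := boolp.choice (fun s => regular_expander s n0 mt tlam pp (ltnW tp)).
pose c := sym_order 'F_p n.+1; pose d i := ((n.+2 - i.+1) * c i.+1 %/ c i.+2)%N.
exists d, (fun s => projT1 (G s)), (fun s => projT2 (G s)).
have dP i : (i.+1 < n.+2)%N -> (0 < d i)%N /\ (d i.+1 < d i)%N.
  by have [_ _ _ _] := GP 0%N; apply.
split=> [i iN|]; first by apply: (dP i _).2; rewrite ltnW // ltnW.
split; first by apply: (dP _ _).1; rewrite prednK // ltnW.
split=> [s|]; first by have [] := GP s.
split=> [s|]; first by have [] := GP s.
split=> [M|s]; last by have [] := GP s.
exists (M * c 1)%N => s Ms; have [_ _ sN _ _] := GP s.
have c0 : (0 < c 1)%N.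
  by case: (posnP (c 1)) (dP 0%N isT) => // c0; rewrite /d c0 muln0 div0n => -[].
by rewrite -(leq_pmul2r c0); apply: leq_trans Ms sN.
Qed.
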